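(* Let $n\ge 1$ and let $G$ be a definable group. Suppose that $G$ admits a compatible system of ideals $\{\mu_{G^k}\}_{1\le k\le n}$ with $\mu_G$ satisfying the right translational $\mathrm{S}1$ property. Assume that the set $w_{G,n}^{-1}(1)=\{(x_1,\ldots,x_n)\in G^n:[x_1,\ldots,x_n]=1\}$ is $\mu_{G^n}$-wide. Then $G$ has an $\emptyset$-definable finite index subgroup which is FC-nilpotent of class $n-1$, and there is an $\emptyset$-definable characteristic subgroup $H$ of $G$ which is nilpotent of class less than $n$ and such that $G/H$ is uniformly locally finite.
   Context: We work in an $\aleph_1$-saturated model $\mathcal M$ of a complete theory with infinite models in a countable language $\mathcal L$. Definable means definable in $\mathcal M$ with parameters. The group $G$ (its domain and operation) is assumed to be definable without parameters. An ideal on a definable set $X$ is a non-empty collection of definable subsets of $X$, closed under definable subsets and finite unions and not containing $X$. Given an ideal $\mu$, a type-definable set is $\mu$-wide if it is not contained in any definable set belonging to $\mu$; a (partial) type is $\mu$-wide if its set of realizations is. An ideal $\mu$ on a definable group $G$ has the right translational $\mathrm{S}1$ property if it is right translation-invariant ($X\in\mu$ implies $Xg\in\mu$ for all $g\in G$) and, for every parameter set $A$ and every $A$-definable $X\subseteq G$, there is no $A$-indiscernible sequence $(g_i)_{i\in\mathbb N}$ in $G$ such that $Xg_i\cap Xg_j\in\mu$ for all $i<j$ but $Xg_i$ is $\mu$-wide for every (equivalently, some) $i$. A family $\{\mu_{G^k}\}_{1\le k\le n}$, with $\mu_{G^k}$ an ideal on $G^k$ (and $\mu_G=\mu_{G^1}$),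 is a compatible system of ideals if for all $1\le i<k\le n$ the ideal $\mu_{G^k}$ is coordinatewise $(\mu_{G^i},\mu_{G^{k-i}})$-compatible, i.e.: for every countable parameter set $A$ and every $A$-definable $\mu_{G^k}$-wide set $Y\subseteq G^k=G^i\times G^{k-i}$ there is $(a,b)\in Y$ with $a\in G^i$, $b\in G^{k-i}$ such that $\mathrm{tp}(a/A)$ is $\mu_{G^i}$-wide and $\mathrm{tp}(b/A,a)$ is $\mu_{G^{k-i}}$-wide. Left normed commutators: $[x_1]=x_1$, $[x_1,\ldots,x_{n+1}]=[[x_1,\ldots,x_n],x_{n+1}]$. For a normal subgroup $N$ of $G$ let $C_G(x/N)=\{g\in G:[g,x]\in N\}$ and $\mathrm{FC}_G(G/N)=\{x\in G:|G:C_G(x/N)|<\infty\}$; put $\mathrm{FC}_0(G)=\{1\}$, $\mathrm{FC}_{i+1}(G)=\mathrm{FC}_G(G/\mathrm{FC}_i(G))$. A group $K$ is FC-nilpotent of class $m$ if $K=\mathrm{FC}_m(K)$. A group is uniformly locally finite if for every $d\ge1$ there is $r$ such that every subgroup generated by $d$ elements has order at most $r$. Nilpotent of class $0$ means trivial. *)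

(* Defs.v *)
From HB Require Import structures.
From mathcomp Require Import all_boot.
From mathcomp Require Import boolp classical_sets functions cardinality.

Set Implicit Arguments.
Unset Strict Implicit.
Unset Printing Implicit Defensive.

Local Open Scope classical_set_scope.
Local Open Scope card_scope.
Local Open Scope group_scope.

Record language := Language {
  fun_symbol : Type;
  fun_arity : fun_symbol -> nat;
  rel_symbol : Type;
  rel_arity : rel_symbol -> nat }.

Definition countable_language (L : language) :=
  countable [set: fun_symbol L] /\ countable [set: rel_symbol L].

Record structure (L : language) := Structure {
  carrier :> Type;
  fint : forall f : fun_symbol L, ('I_(fun_arity f) -> carrier) -> carrier;
  rint : forall r : rel_symbol L, ('I_(rel_arity r) -> carrier) -> Prop }.

Section Syntax.
Variable L : language.

Inductive term (V : Type) : Type :=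
| Var of V
| App (f : fun_symbol L) of ('I_(fun_arity f) -> term V).

(* The free variables of a formula are indexed by an arbitrary type V; a
   quantifier binds the variable None of option V.  Classically the connectives
   below suffice. *)
Inductive formula (V : Type) : Type :=
| Falsum
| Equal of term V & term V
| Rel (r : rel_symbol L) of ('I_(rel_arity r) -> term V)
| Imp of formula V & formula V
| Forall of formula (option V).

Variable M : structure L.

Fixpoint eval (V : Type) (v : V -> M) (t : term V) : M :=
  match t with
  | Var x => v x
  | App f a => fint (fun i => eval v (a i))
  end.

Definition extend (V : Type) (v : V -> M) (a : M) (o : option V) : M :=
  if o is Some x then v x else a.

Fixpoint sat (V : Type) (p : formula V) : (V -> M) -> Prop :=
  match p with
  | Falsum => fun _ => False
  | Equal s t => fun v => eval v s = eval v t
  | Rel r a => fun v => rint (fun i => eval v (a i))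
  | Imp p q => fun v => sat p v -> sat q v
  | Forall p => fun v => forall a : M, sat p (extend v a)
  end.

End Syntax.

Section ModelTheory.
Variables (L : language) (M : structure L).

(* A formula in the variables I with parameters from A: an element a of A is a
   free variable (inr a), always interpreted as a itself. *)
Definition formula_over (A : set M) (I : Type) := formula L (I + A)%type.

Definition with_params (A : set M) (I : Type) (v : I -> M) (u : I + A) : M :=
  match u with inl i => v i | inr a => val a end.

Definition sat_over (A : set M) (I : Type) (p : formula_over A I) (v : I -> M) :=
  sat p (with_params v).

Definition tp (A : set M) (I : Type) (v : I -> M) : set (formula_over A I) :=
  [set p | sat_over p v].

Definition aleph1_saturated :=
  forall (A : set M) (k : nat) (S : set (formula_over A 'I_k)),
    countable A ->
    (forall F : set (formula_over A 'I_k), finite_set F -> F `<=` S ->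
       exists v : 'I_k -> M, forall p, F p -> sat_over p v) ->
    exists v : 'I_k -> M, forall p, S p -> sat_over p v.

End ModelTheory.

Arguments tp {L M} A {I} v.

(* The elements of a definable set X of M^I are given as the elements of a type
   P together with their coordinates, an injective map c : P -> (I -> M) whose
   range is X. *)

Section Coordinates.
Variables (L : language) (M : structure L) (P I : Type) (c : P -> I -> M).

Definition definable (A : set M) (X : set P) :=
  exists p : formula_over A I, c @` X = [set v | sat_over p v].

Definition realizations (A : set M) (S : set (formula_over A I)) : set P :=
  [set x | forall p, S p -> sat_over p (c x)].

Definition ideal (mu : set (set P)) :=
  [/\ exists X, mu X,
      forall X, mu X -> definable setT X,
      forall X Y, mu X -> definable setT Y -> Y `<=` X -> mu Y,
      forall X Y, mu X -> mu Y -> mu (X `|` Y)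
    & ~ mu setT].

Definition wide (mu : set (set P)) (Y : set P) :=
  forall X, mu X -> ~ Y `<=` X.

Definition wide_type (mu : set (set P)) (A : set M) (S : set (formula_over A I)) :=
  wide mu (realizations S).

Definition indiscernible (A : set M) (g : nat -> P) :=
  forall (r : nat) (s t : r.-tuple nat), sorted ltn s -> sorted ltn t ->
    tp A (fun q : 'I_r * I => c (g (tnth s q.1)) q.2) =
    tp A (fun q : 'I_r * I => c (g (tnth t q.1)) q.2).

End Coordinates.

Section DefinableGroup.
Variables (L : language) (M : structure L) (G : groupType) (m : nat).
Variable c : G -> 'I_m -> M.

(* G^k as a definable subset of M^(k m) *)
Definition coords (k : nat) (x : k.-tuple G) (q : 'I_k * 'I_m) : M :=
  c (tnth x q.1) q.2.

Definition definable_group :=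
  [/\ injective c,
      definable c set0 [set: G]
    & definable (@coords 3) set0 [set [tuple of [:: x; y; x * y]] | x in setT & y in setT]].

(* the identification of G^1 with G *)
Definition ideal_on_G (mu1 : set (set (1.-tuple G))) : set (set G) :=
  [set X | mu1 [set x | X (thead x)]].

Definition rtranslate (X : set G) (g : G) : set G := [set x * g | x in X].

Definition right_translational_S1 (mu : set (set G)) :=
  (forall X g, mu X -> mu (rtranslate X g)) /\
  forall (A : set M) (X : set G), definable c A X ->
    ~ exists g : nat -> G,
        [/\ indiscernible c A g,
            forall i j, (i < j)%N ->
              mu (rtranslate X (g i) `&` rtranslate X (g j))
          & forall i, wide mu (rtranslate X (g i))].

(* G^(i+j) is identified with G^i x G^j by concatenation *)
Definition compatible_ideals (i j : nat) (mu : set (set ((i + j).-tuple G)))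
    (mu1 : set (set (i.-tuple G))) (mu2 : set (set (j.-tuple G))) :=
  forall (A : set M) (Y : set ((i + j).-tuple G)),
    countable A -> definable (@coords (i + j)) A Y -> wide mu Y ->
    exists (a : i.-tuple G) (b : j.-tuple G),
      [/\ Y [tuple of a ++ b],
          wide_type (@coords i) mu1 (tp A (coords a))
        & wide_type (@coords j) mu2 (tp (A `|` range (coords a)) (coords b))].

Definition compatible_system (n : nat) (mu : forall k, set (set (k.-tuple G))) :=
  (forall k, (0 < k <= n)%N -> ideal (@coords k) (mu k)) /\
  forall i j, (0 < i)%N -> (0 < j)%N -> (i + j <= n)%N ->
    compatible_ideals (mu (i + j)) (mu i) (mu j).

End DefinableGroup.

Section GroupTheory.
Variable G : groupType.
Implicit Types (H K N : set G) (x g : G).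

(* [x_1, ..., x_n], left normed; the value on the empty sequence is irrelevant *)
Definition left_commutator (s : seq G) : G :=
  if s is x :: s' then foldl commg x s' else 1.

Definition subgroup K := group_closed (mem K).

Definition generated (S : set G) : set G := smallest subgroup S.

Definition right_coset H g : set G := [set h * g | h in H].

Definition finite_index H K := finite_set [set right_coset H g | g in K].

(* C_K(x/N); the FC notions are relative to a subgroup K, so that they apply
   to a finite index subgroup as well as to the whole group *)
Definition centralizer_mod K N x : set G := [set g | K g /\ N [~ g, x]].

Definition FC_mod K N : set G :=
  [set x | K x /\ finite_index (centralizer_mod K N x) K].

Fixpoint FC_series K (i : nat) : set G :=
  if i is i'.+1 then FC_mod K (FC_series K i') else [set 1].

Definition FC_nilpotent K (m : nat) := K = FC_series K m.

(* lower_central H i is the term of index i+1 of the lower central series of H *)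
Fixpoint lower_central H (i : nat) : set G :=
  if i is i'.+1 then
    generated [set [~ x, y] | x in lower_central H i' & y in H]
  else H.

Definition nilpotent_of_class H (m : nat) :=
  lower_central H m = [set 1] /\
  forall j, (j < m)%N -> lower_central H j <> [set 1].

Definition characteristic H :=
  forall f : {multiplicative G -> G}, bijective f -> f @` H = H.

Definition uniformly_locally_finite :=
  forall d : nat, (0 < d)%N ->
    exists r : nat, forall a : 'I_d -> G, generated (range a) #<= `I_r.

Record normal_subgroup := NormalSubgroup {
  nsub :> set G;
  nsub_closed : subgroup nsub;
  nsub_conj : forall x g, nsub x -> nsub (x ^ g) }.

End GroupTheory.

Arguments uniformly_locally_finite : clear implicits.

(* G/N as the set of right cosets of N with the product of subsets *)

Section Quotient.
Variables (G : groupType) (N : normal_subgroup G).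

Definition quotient : Type := range (right_coset N).

HB.instance Definition _ := Choice.on quotient.

Lemma right_coset_in (g : G) : right_coset N g \in range (right_coset N).
Proof. by rewrite inE; exists g. Qed.

Definition quotient_map (g : G) : quotient := SigSub (right_coset_in g).

Lemma quotient_ind (Q : quotient -> Prop) :
  (forall g, Q (quotient_map g)) -> forall X, Q X.
Proof.
move=> HQ X; have [g _ eX] := set_mem (valP X).
by have -> : X = quotient_map g by apply: val_inj.
Qed.

Lemma nsub1 : nsub N 1.
Proof. by have [/set_mem] := nsub_closed N. Qed.

Lemma nsubF x y : nsub N x -> nsub N y -> nsub N (x / y).
Proof.
have [_ h] := nsub_closed N => Nx Ny.
by apply/set_mem/h; rewrite inE.
Qed.

Lemma nsubV x : nsub N x -> nsub N x^-1.
Proof. by move=> Nx; rewrite -(mul1g x^-1); apply: nsubF => //; exact: nsub1. Qed.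

Lemma nsubM x y : nsub N x -> nsub N y -> nsub N (x * y).
Proof. by move=> Nx Ny; rewrite -(invgK y); apply: nsubF => //; exact: nsubV. Qed.

Lemma nsubJV x g : nsub N x -> nsub N (g * x * g^-1).
Proof. by move=> /(nsub_conj g^-1); rewrite /conjg invgK mulgA. Qed.

Definition set_mul (X Y : set G) : set G := [set x * y | x in X & y in Y].
Definition set_inv (X : set G) : set G := [set x^-1 | x in X].

Lemma right_cosetM g h :
  set_mul (right_coset N g) (right_coset N h) = right_coset N (g * h).
Proof.
apply/seteqP; split=> z.
  move=> [_ [x Nx <-]] [_ [y Ny <-]] <-.
  exists (x * (g * y * g^-1)); first by apply: nsubM => //; exact: nsubJV.
  by rewrite !mulgA mulgVK.
move=> [x Nx <-]; exists (x * g); first by exists x.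
by exists (1 * h); [exists 1 => //; exact: nsub1 | rewrite mul1g mulgA].
Qed.

Lemma right_cosetV g : set_inv (right_coset N g) = right_coset N g^-1.
Proof.
apply/seteqP; split=> z.
  move=> [_ [x Nx <-]] <-; exists (x^-1 ^ g); first exact/nsub_conj/nsubV.
  by rewrite invgM /conjg -!mulgA mulgV mulg1.
move=> [x Nx <-]; exists ((g * x * g^-1)^-1 * g).
  by exists (g * x * g^-1)^-1 => //; exact/nsubV/nsubJV.
by rewrite invgM invgK !mulgA mulVg mul1g.
Qed.

Lemma set_mul_in (X Y : quotient) :
  set_mul (val X) (val Y) \in range (right_coset N).
Proof.
elim/quotient_ind: X => g; elim/quotient_ind: Y => h /=.
by rewrite right_cosetM right_coset_in.
Qed.

Lemma set_inv_in (X : quotient) : set_inv (val X) \in range (right_coset N).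
Proof. by elim/quotient_ind: X => g /=; rewrite right_cosetV right_coset_in. Qed.

Definition quotient_mul (X Y : quotient) : quotient := SigSub (set_mul_in X Y).
Definition quotient_inv (X : quotient) : quotient := SigSub (set_inv_in X).

Lemma quotient_mapM g h :
  quotient_mul (quotient_map g) (quotient_map h) = quotient_map (g * h).
Proof. exact/val_inj/right_cosetM. Qed.

Lemma quotient_mapV g : quotient_inv (quotient_map g) = quotient_map g^-1.
Proof. exact/val_inj/right_cosetV. Qed.

Lemma quotient_mulA : associative quotient_mul.
Proof.
elim/quotient_ind=> x; elim/quotient_ind=> y; elim/quotient_ind=> z.
by rewrite !quotient_mapM mulgA.
Qed.

Lemma quotient_mul1 : left_id (quotient_map 1) quotient_mul.
Proof. by elim/quotient_ind=> x; rewrite quotient_mapM mul1g. Qed.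

Lemma quotient_mulr1 : right_id (quotient_map 1) quotient_mul.
Proof. by elim/quotient_ind=> x; rewrite quotient_mapM mulg1. Qed.

Lemma quotient_mulV : left_inverse (quotient_map 1) quotient_inv quotient_mul.
Proof. by elim/quotient_ind=> x; rewrite quotient_mapV quotient_mapM mulVg. Qed.

Lemma quotient_mulrV : right_inverse (quotient_map 1) quotient_inv quotient_mul.
Proof. by elim/quotient_ind=> x; rewrite quotient_mapV quotient_mapM mulgV. Qed.

HB.instance Definition _ := isGroup.Build quotient
  quotient_mulA quotient_mul1 quotient_mulr1 quotient_mulV quotient_mulrV.

End Quotient.

(* Main.v *)
Require Import Defs.
From mathcomp Require Import all_boot.
From mathcomp Require Import boolp classical_sets functions cardinality.
From mathcomp Require Import filter.

Set Implicit Arguments.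
Unset Strict Implicit.
Unset Printing Implicit Defensive.

Local Open Scope classical_set_scope.
Local Open Scope group_scope.

(** The FC-series of G is approximated from inside by sets with a bound on every
    index that occurs: [FC_filt 0 N] is {1}, and x lies in [FC_filt i.+1 N] when G is covered
    by N + 1 right translates of {g | [g, x] in FC_filt i N}. These sets are
    0-definable and invariant under automorphisms, they increase with N, and the
    product of two of them lies in a third ([next_filtration]), so their union over
    N is a characteristic subgroup contained in FC_i(G).

    Wide sets are syndetic: if X is wide, finitely many right translates of X^-1 X
    cover G ([wide_covered]). Otherwise there is an infinite sequence h with the
    translates X h_i pairwise disjoint; the average type of h along a nonprincipal
    ultrafilter is finitely satisfiable in h, hence a sequence of successive
    realizations of it is indiscernible, and it inherits disjointness. All
    translates of X are wide, which contradicts the S1 property.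

    Now let the set of n-tuples with [x_1, ..., x_n] = 1 be wide. Compatibility
    yields a wide type of (n-1)-tuples a such that {z | [[a], z] = 1} is wide, where
    [a] is the left normed commutator; this set is a centralizer, so it has finite
    index, and [a] lies in some FC_filt 1 N, a definable condition on a. Repeating
    this, [x_1, ..., x_(n-k)] lies in some FC_filt k N for a wide set of
    (n-k)-tuples ([descent_all]); for k = n - 1 the set FC_filt (n-1) N is wide. So
    the union K of the sets FC_filt (n-1) N has finite index in G, and K is equal to
    one of them ([FC_union_definable]), hence definable. It is FC-nilpotent because
    the part in K of the union of the FC_filt i N is contained in FC_i(K).

    For the second part, if G is covered by N + 1 translates of the set of elements
    centralizing x modulo a normal subgroup, then the powers of each y return to
    that centralizer with an exponent at most N + 1. Climbing the filtration gives
    one e > 0 with [x_1, x_2^e, ..., x_n^e] = 1 on K ([FC_filt_power]). So the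
    subgroups U_0 = 1, U_(j+1) = {h in K | [h, x^e] in U_j for all x in K} reach
    U_(n-1) = K. Let H be the subgroup of the elements of K that centralize every
    quotient U_(j+1) / U_j. It is definable and characteristic, it contains all
    x^e with x in K, and its lower central series descends along the U_j, so it is
    nilpotent of class at most n - 1.

    Finally, modulo H the successive quotients of the FC-series have bounded
    exponent and finite conjugacy classes, and so they are locally finite; local
    finiteness is stable under extensions by Schreier's lemma, so G / H is locally
    finite. Having at most r cosets of H in the group generated by a_1, ..., a_d
    follows from a definable condition on a, so saturation makes r depend on d
    only. *)

(** * Formulas: renaming and blocks of quantifiers *)

Section Renaming.
Variables (L : language) (M : structure L).

Fixpoint map_term (V W : Type) (f : V -> W) (t : term L V) : term L W :=
  match t with
  | Var x => @Var L W (f x)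
  | App g a => App (fun i => map_term f (a i))
  end.

Fixpoint map_formula (V : Type) (p : formula L V) :
    forall W : Type, (V -> W) -> formula L W :=
  match p with
  | Falsum => fun W _ => Falsum L W
  | Equal s t => fun W f => Equal (map_term f s) (map_term f t)
  | Rel r a => fun W f => Rel (fun i => map_term f (a i))
  | Imp p q => fun W f => Imp (map_formula p f) (map_formula q f)
  | Forall p => fun W f => Forall (map_formula p (omap f))
  end.

Lemma eval_map (V W : Type) (f : V -> W) (v : W -> M) (t : term L V) :
  eval v (map_term f t) = eval (v \o f) t.
Proof.
elim: t => [//|g a IH] /=; congr (fint _); apply/funext => i; exact: IH.
Qed.

Lemma sat_map (V : Type) (p : formula L V) (W : Type) (f : V -> W) (v : W -> M) :
  sat (map_formula p f) v = sat p (v \o f).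
Proof.
elim: p W f v => {V} [V|V s t|V r a|V p IHp q IHq|V p IHp] W f v //=.
- by rewrite !eval_map.
- by congr (rint _); apply/funext => i; rewrite eval_map.
- by rewrite IHp IHq.
apply: eq_forall => a; rewrite IHp; congr (sat p _).
by apply/funext => -[].
Qed.

Definition sum_fun (I J T : Type) (f : I -> T) (g : J -> T) (u : I + J) : T :=
  match u with inl i => f i | inr j => g j end.

(** A formula quantifies one variable at a time, while an element of the group has
    m coordinates. *)
Lemma forall_block (k : nat) (V : Type) (p : formula L ('I_k + V)) :
  exists q : formula L V,
    forall v : V -> M, sat q v <-> forall w : 'I_k -> M, sat p (sum_fun w v).
Proof.
elim: k V p => [|k IH] V p.
  exists (map_formula p (sum_fun (fun i : 'I_0 => False_rect V (notF (ltn_ord i))) id)).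
  move=> v; rewrite sat_map; split=> [h w|/(_ (fun i => False_rect M (notF (ltn_ord i))))].
    by congr (sat p _): h; apply/funext => -[[]|].
  by congr (sat p _); apply/funext => -[[]|].
pose f (u : 'I_k.+1 + V) : 'I_k + option V :=
  match u with
  | inl i => if unlift ord0 i is Some j then inl j else inr None
  | inr x => inr (Some x)
  end.
have [q hq] := IH _ (map_formula p f).
exists (Forall q) => v /=; split=> [h w|h a].
  have := (hq (extend v (w ord0))).1 (h _) (fun j => w (lift ord0 j)).
  rewrite sat_map; congr (sat p _); apply/funext => -[i|x] //=.
  by case: unliftP => [j ->|->].
apply/hq => w.
pose w' (i : 'I_k.+1) := if unlift ord0 i is Some j then w j else a.
rewrite sat_map; move: (h w'); congr (sat p _); apply/funext => -[i|x] //=.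
by rewrite /w'; case: unliftP.
Qed.

(** All changes of variables and parameters are instances of this one: x ranges over
    the assignments, and the hypothesis says that every variable or parameter of p
    has a counterpart with the same value whatever x is. *)
Lemma sat_over_transport (X : Type) (A B : set M) (I J : Type)
    (F : X -> I -> M) (F' : X -> J -> M) (p : formula_over A I) :
  (forall u : I + A, exists w : J + B,
     forall x, with_params (F' x) w = with_params (F x) u) ->
  exists q : formula_over B J, forall x, sat_over q (F' x) <-> sat_over p (F x).
Proof.
move=> /choice[f hf]; exists (map_formula p f) => x.
rewrite /sat_over sat_map (_ : _ \o f = with_params (F x)) //.
by apply/funext => u /=.
Qed.

End Renaming.

(** * Definable relations on a definable group *)

Section DefinableRelations.
Variables (L : language) (M : structure L) (G : groupType) (m : nat).
Variable c : G -> 'I_m -> M.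
Hypothesis Gdef : definable_group c.

(** Definability of a relation between the elements of a family indexed by I; every
    element of the group occupies m variables. The truth value of the formula
    matters only on coordinates of elements of the group, which makes the class
    closed under connectives without relativization. The index type is arbitrary, so
    that [option I] adds a variable to bind and [unit] gives subsets of G. *)
Definition dfn (A : set M) (I : Type) (P : (I -> G) -> Prop) :=
  exists p : formula_over A (I * 'I_m),
    forall v, P v <-> sat_over p (fun q => c (v q.1) q.2).

Lemma c_inj : injective c. Proof. by case: Gdef. Qed.

Lemma coords_inj k : injective (@coords L M G m c k).
Proof.
move=> x y e; apply: eq_from_tnth => i; apply: c_inj; apply/funext => l.
exact: (congr1 (fun f => f (i, l)) e).
Qed.

Lemma dfn_ext A I (P Q : (I -> G) -> Prop) :
  (forall v, P v <-> Q v) -> dfn A P -> dfn A Q.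
Proof. by move=> h [p hp]; exists p => v; rewrite -h. Qed.

Lemma dfn_imp A I (P Q : (I -> G) -> Prop) :
  dfn A P -> dfn A Q -> dfn A (fun v => P v -> Q v).
Proof.
move=> [p hp] [q hq]; exists (Imp p q) => v.
by rewrite /sat_over /=; have := hp v; have := hq v; rewrite /sat_over; tauto.
Qed.

Lemma dfn_False A I : dfn A (fun _ : I -> G => False).
Proof. by exists (Falsum _ _). Qed.

Lemma dfn_not A I (P : (I -> G) -> Prop) : dfn A P -> dfn A (fun v => ~ P v).
Proof. by move=> h; apply: dfn_imp h (dfn_False _ _). Qed.

Lemma dfn_True A I : dfn A (fun _ : I -> G => True).
Proof. by apply: dfn_ext (dfn_not (dfn_False A I)) => v; tauto. Qed.

Lemma dfn_and A I (P Q : (I -> G) -> Prop) :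
  dfn A P -> dfn A Q -> dfn A (fun v => P v /\ Q v).
Proof.
move=> hP hQ; apply: dfn_ext (dfn_not (dfn_imp hP (dfn_not hQ))) => v.
by have := EM (P v); have := EM (Q v); tauto.
Qed.

Lemma dfn_forall_fin A I (J : finType) (P : J -> (I -> G) -> Prop) :
  (forall j, dfn A (P j)) -> dfn A (fun v => forall j, P j v).
Proof.
move=> hP.
suff h (s : seq J) : dfn A (fun v => forall j, j \in s -> P j v).
  by apply: dfn_ext (h (enum J)) => v; split=> H j; [apply: H; rewrite mem_enum|].
elim: s => [|j s IH]; first by apply: dfn_ext (dfn_True A I).
apply: dfn_ext (dfn_and (hP j) IH) => v; split.
  by move=> [Hj Hs] i; rewrite inE => /orP[/eqP->|/Hs].
by move=> H; split=> [|i si]; apply: H; rewrite inE ?eqxx // si orbT.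
Qed.

Lemma dfn_exists_fin A I (J : finType) (P : J -> (I -> G) -> Prop) :
  (forall j, dfn A (P j)) -> dfn A (fun v => exists j, P j v).
Proof.
move=> hP.
apply: dfn_ext (dfn_not (dfn_forall_fin (fun j => dfn_not (hP j)))) => v.
split; last by move=> [j Hj] /(_ j).
by move=> H; apply: contrapT => N; apply: H => j Pj; apply: N; exists j.
Qed.

(** Renaming and specialization at once: [t] sends a variable to another one, or
    turns it into parameters. *)
Lemma dfn_subst (A B : set M) I J (t : J -> I + G) (P : (J -> G) -> Prop) :
  A `<=` B -> (forall j g, t j = inr g -> forall l, B (c g l)) ->
  dfn A P -> dfn B (fun v => P (fun j => sum_fun v id (t j))).
Proof.
move=> AB tB [p hp].
pose F (v : I -> G) (q : J * 'I_m) := c (sum_fun v id (t q.1)) q.2.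
pose F' (v : I -> G) (q : I * 'I_m) := c (v q.1) q.2.
have [|q hq] := @sat_over_transport L M _ A B _ _ F F' p.
  move=> [[j l]|[a Aa]]; last by exists (inr (SigSub (mem_set (AB _ (set_mem Aa))))).
  rewrite /F /F'; case E: (t j) => [i|g]; first by exists (inl (i, l)) => v /=; rewrite E.
  by exists (inr (SigSub (mem_set (tB _ _ E l)))) => v /=; rewrite E.
by exists q => v; rewrite hp -/(F' v) hq.
Qed.

Lemma dfn_var A I J (f : J -> I) (P : (J -> G) -> Prop) :
  dfn A P -> dfn A (fun v => P (fun j => v (f j))).
Proof. by apply: (@dfn_subst A A I J (fun j => inl (f j))). Qed.

Lemma dfn_params A B I (P : (I -> G) -> Prop) : A `<=` B -> dfn A P -> dfn B P.
Proof. by move=> AB; apply: (@dfn_subst A B I I inl). Qed.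

(** A quantifier over G is a block of quantifiers over M relativized to the range
    of the coordinates, which is definable. *)
Lemma dfn_forall A I (P : G -> (I -> G) -> Prop) :
  dfn A (fun v : option I -> G => P (v None) (fun i => v (Some i))) ->
  dfn A (fun v => forall x, P x v).
Proof.
move=> [p hp]; have [_ [r hr] _] := Gdef.
pose f (u : option I * 'I_m + A) : 'I_m + (I * 'I_m + A) :=
  match u with
  | inl (None, l) => inl l
  | inl (Some i, l) => inr (inl (i, l))
  | inr a => inr (inr a)
  end.
pose g (u : 'I_m + (set0 : set M)) : 'I_m + (I * 'I_m + A) :=
  match u with inl l => inl l | inr a => False_rect _ (set_mem (valP a)) end.
have [q hq] := forall_block M (Imp (map_formula r g) (map_formula p f)).
exists q => v; rewrite /sat_over hq.
have satr w : sat (map_formula r g) (sum_fun w (with_params (A := A) (fun q => c (v q.1) q.2)))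
    <-> exists x, c x = w.
  have -> : (exists x, c x = w) = (c @` setT) w.
    by apply/propext; split=> [[x e]|[x _ e]]; exists x.
  rewrite hr /sat_over sat_map /=.
  have -> // : sum_fun w (with_params (A := A) (fun q => c (v q.1) q.2)) \o g = with_params w.
  by apply/funext => -[//|a]; case: (set_mem (valP a)).
have satp x : sat (map_formula p f) (sum_fun (c x) (with_params (A := A) (fun q => c (v q.1) q.2)))
    <-> P x v.
  rewrite (hp (oapp v x)) /sat_over sat_map.
  have -> // : sum_fun (c x) (with_params (A := A) (fun q => c (v q.1) q.2)) \o f
     = with_params (fun q => c (oapp v x q.1) q.2).
  by apply/funext => -[[[i|] l]|a].
split=> [H w /satr[x <-]|H x]; first by apply/satp.
by apply/satp/H/satr; exists x.
Qed.

Lemma dfn_exists A I (P : G -> (I -> G) -> Prop) :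
  dfn A (fun v : option I -> G => P (v None) (fun i => v (Some i))) ->
  dfn A (fun v => exists x, P x v).
Proof.
move=> /dfn_not/(dfn_forall (P := fun x v => ~ P x v))/dfn_not; apply: dfn_ext => v.
split; last by move=> [x Px] /(_ x).
by move=> H; apply: contrapT => N; apply: H => x Px; apply: N; exists x.
Qed.

Lemma dfn_exists_block k A I (P : ('I_k -> G) -> (I -> G) -> Prop) :
  dfn A (fun v : 'I_k + I -> G => P (fun i => v (inl i)) (fun i => v (inr i))) ->
  dfn A (fun v => exists w, P w v).
Proof.
elim: k I P => [|k IH] I P h.
  apply: dfn_ext (dfn_var (sum_fun (fun i : 'I_0 => False_rect I (notF (ltn_ord i))) id) h) => v /=.
  split=> [H|[w]]; first by eexists; apply: H.
  by congr (P _ _); apply/funext => -[].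
pose cons (x : G) (w : 'I_k -> G) i := if unlift ord0 i is Some j then w j else x.
apply: (@dfn_ext _ _ (fun v => exists x, exists w, P (cons x w) v)).
  move=> v; split=> [[x [w Pw]]|[w Pw]]; first by exists (cons x w).
  exists (w ord0), (fun j => w (lift ord0 j)); congr (P _ _): Pw.
  by apply/funext => i; rewrite /cons; case: unliftP => [j ->|->].
apply: dfn_exists; apply: (IH (option I) (fun w v => P (cons (v None) w) (fun i => v (Some i)))).
pose f (u : 'I_k.+1 + I) : 'I_k + option I :=
  match u with
  | inl i => if unlift ord0 i is Some j then inl j else inr None
  | inr x => inr (Some x)
  end.
apply: dfn_ext (dfn_var f h) => v.
rewrite (_ : (fun i => _) = cons (v (inr None)) (fun i => v (inl i))) //.
by apply/funext => i; rewrite /f /cons; case: unliftP.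
Qed.

Lemma dfn_of_definable A k (Y : set (k.-tuple G)) :
  definable (@coords L M G m c k) A Y ->
  dfn A (fun v : 'I_k -> G => Y [tuple v i | i < k]).
Proof.
move=> [p hp]; exists p => v.
have e : coords c [tuple v i | i < k] = fun q => c (v q.1) q.2.
  by apply/funext => q; rewrite /coords tnth_mktuple.
have := congr1 (fun S => S (coords c [tuple v i | i < k])) hp.
rewrite /= e => <-.
split=> [Yv|[y Yy]]; first by exists [tuple v i | i < k].
by rewrite -e => /coords_inj <-.
Qed.

Lemma dfn_in_G A I (i : I) : exists p : formula_over A (I * 'I_m),
  forall w, sat_over p w <-> exists x, c x = fun l => w (i, l).
Proof.
have [_ [r hr] _] := Gdef.
have [|q hq] := @sat_over_transport L M _ set0 A _ _
    (fun (w : I * 'I_m -> M) l => w (i, l)) id r.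
  by move=> [l|[a /set_mem[]]]; exists (inl (i, l)).
exists q => w; rewrite hq.
move: (congr1 (fun S => S (fun l => w (i, l))) hr) => /= <-.
by split=> [[x _ e]|[x e]]; exists x.
Qed.

(** A formula witnessing [dfn] is unconstrained outside of the coordinates of
    elements of [G]; relativizing it makes it define exactly the relation. *)
Lemma dfn_exact A (I : finType) (P : (I -> G) -> Prop) : dfn A P ->
  exists p : formula_over A (I * 'I_m),
    forall w, sat_over p w <-> exists2 v, P v & w = fun q => c (v q.1) q.2.
Proof.
move=> [p hp].
suff [q hq] : exists q : formula_over A (I * 'I_m), forall w, sat_over q w <->
    forall i, i \in enum I -> exists x, c x = fun l => w (i, l).
  exists (Imp (Imp p (Imp q (Falsum _ _))) (Falsum _ _)) => w.
  have hand (X Y : Prop) : ((X -> Y -> False) -> False) <-> X /\ Y.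
    by have := EM X; have := EM Y; tauto.
  rewrite /sat_over /= hand; have := hq w; rewrite /sat_over => ->; split.
    move=> [pw qw]; have /choice[v hv] i : exists x, c x = fun l => w (i, l).
      by apply: qw; rewrite mem_enum.
    have ew : w = fun q => c (v q.1) q.2 by apply/funext => -[i l]; rewrite hv.
    by exists v => //; apply/hp; rewrite -ew.
  by move=> [v /hp Pv ->]; split=> // i _; exists (v i).
elim: (enum I) => [|i s [q hq]]; first by exists (Imp (Falsum _ _) (Falsum _ _)) => w; split=> [_ i|_ []].
have [r hr] := dfn_in_G A i.
exists (Imp (Imp q (Imp r (Falsum _ _))) (Falsum _ _)) => w.
rewrite /sat_over /=; have := hq w; have := hr w; rewrite /sat_over => -> ->.
split=> [H j|H N].
  have /not_implyP[hs /contrapT hj] := H.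
  by rewrite inE => /orP[/eqP->|/hs].
apply: N => [j sj|]; apply: H; rewrite inE ?eqxx //.
by rewrite sj orbT.
Qed.

Lemma definable_of_dfn A k (Y : set (k.-tuple G)) :
  dfn A (fun v : 'I_k -> G => Y [tuple v i | i < k]) ->
  definable (@coords L M G m c k) A Y.
Proof.
move=> /dfn_exact[p hp]; exists p; apply/seteqP; split=> [_ [x Yx <-]|w /= /hp[v Yv ->]].
  apply/hp; exists (tnth x) => //.
  by rewrite (_ : [tuple _ | _ < k] = x) //; apply: eq_from_tnth => i; rewrite tnth_mktuple.
exists [tuple v i | i < k] => //.
by apply/funext => q; rewrite /coords tnth_mktuple.
Qed.

Lemma definable_of_dfn1 A (X : set G) :
  dfn A (fun v : unit -> G => X (v tt)) -> definable c A X.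
Proof.
move=> /dfn_exact[p hp].
have [|q hq] := @sat_over_transport L M _ A A _ _
    (fun (w : 'I_m -> M) (q : unit * 'I_m) => w q.2) id p.
  by move=> [[[] l]|a]; [exists (inl l)|exists (inr a)].
exists q; apply/seteqP; split=> [_ [x Xx <-]|w /= /hq/hp[v Xv ew]].
  by apply/hq/hp; exists (fun _ => x).
exists (v tt) => //; apply/funext => l.
exact: esym (congr1 (fun f => f (tt, l)) ew).
Qed.

Lemma dfn_mul A I (i j k : I) : dfn A (fun v => v i * v j = v k).
Proof.
have [_ _ /dfn_of_definable h] := Gdef.
pose f (x : 'I_3) := if val x is n.+1 then if n is _.+1 then k else j else i.
apply: dfn_ext (dfn_var f (dfn_params (@sub0set _ A) h)) => v; split.
  move=> [x _ [y _ E]]; have h3 a := congr1 (fun t : 3.-tuple G => tnth t a) E.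
  move: (h3 (@Ordinal 3 0 isT)) (h3 (@Ordinal 3 1 isT)) (h3 (@Ordinal 3 2 isT)).
  by rewrite /= !tnth_mktuple /f /= => <- <- <-.
move=> e; exists (v i) => //; exists (v j) => //; apply: eq_from_tnth => x.
rewrite [RHS]tnth_mktuple /f.
by case: x => -[|[|[|]]] //= _; rewrite (tnth_nth 1) /= ?e.
Qed.

(** Equality is expressed through multiplication by the idempotent 1. *)
Lemma dfn_eq A I (i j : I) : dfn A (fun v => v i = v j).
Proof.
apply: (@dfn_ext _ _ (fun v => exists x, x * x = x /\ v i * x = v j)).
  move=> v; split=> [[x [e <-]]|<-]; last by exists 1; rewrite !mulg1.
  by have -> : x = 1; [apply: (mulgI x); rewrite e mulg1|rewrite mulg1].
apply: (@dfn_exists _ _ (fun x v => x * x = x /\ v i * x = v j)).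
by apply: dfn_and; apply: dfn_mul.
Qed.

(** A definable function into G, given by its graph: group words are definable
    functions, and definable sets can be composed with them ([dfn_term]). *)
Definition dterm (A : set M) (I : Type) (t : (I -> G) -> G) :=
  dfn A (fun v : option I -> G => v None = t (fun i => v (Some i))).

Lemma dfn_term A I (X : set G) (t : (I -> G) -> G) :
  dfn A (fun v : unit -> G => X (v tt)) -> dterm A t -> dfn A (fun v => X (t v)).
Proof.
move=> hX ht; apply: (@dfn_ext _ _ (fun v => exists x, x = t v /\ X x)).
  by move=> v; split=> [[x [-> //]]|]; exists (t v).
apply: (@dfn_exists _ _ (fun x v => x = t v /\ X x)); apply: dfn_and => //.
exact: (dfn_var (fun _ => None) hX).
Qed.

Lemma dterm_var A I (i : I) : dterm A (fun v => v i).
Proof. exact: dfn_eq. Qed.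

Lemma dterm_1 A I : dterm A (fun _ : I -> G => 1).
Proof.
apply: (@dfn_ext _ _ (fun v : option I -> G => v None * v None = v None)).
  by move=> v; split=> [e|->]; [apply: (mulgI (v None)); rewrite e mulg1|rewrite mulg1].
exact: dfn_mul.
Qed.

Lemma dterm_mul A I (s t : (I -> G) -> G) :
  dterm A s -> dterm A t -> dterm A (fun v => s v * t v).
Proof.
move=> hs ht; apply: (@dfn_ext _ _ (fun v : option I -> G => exists x, exists y,
   x = s (fun i => v (Some i)) /\ y = t (fun i => v (Some i)) /\ x * y = v None)).
  move=> v; split=> [[x [y [-> [-> ->]]]] //|e].
  by exists (s (fun i => v (Some i))), (t (fun i => v (Some i))).
apply: (@dfn_exists _ _ (fun x (v : option I -> G) => exists y,
   x = s (fun i => v (Some i)) /\ y = t (fun i => v (Some i)) /\ x * y = v None)).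
apply: (@dfn_exists _ _ (fun y (v : option (option I) -> G) =>
   v None = s (fun i => v (Some (Some i))) /\ y = t (fun i => v (Some (Some i)))
   /\ v None * y = v (Some None))).
pose f (y : option (option (option I))) (o : option I) :=
  if o is Some i then Some (Some (Some i)) else y.
have hs' := dfn_var (f (Some None)) hs; have ht' := dfn_var (f None) ht.
by apply: dfn_and => //; apply: dfn_and => //; exact: dfn_mul.
Qed.

Lemma dterm_inv A I (t : (I -> G) -> G) : dterm A t -> dterm A (fun v => (t v)^-1).
Proof.
move=> ht; apply: (@dfn_ext _ _ (fun v : option I -> G => exists x, exists o,
   x = t (fun i => v (Some i)) /\ o = 1 /\ x * v None = o)).
  move=> v; split=> [[x [y [-> [-> /mulg1_eq->]]]] //|->].
  by exists (t (fun i => v (Some i))), 1; rewrite mulgV.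
apply: (@dfn_exists _ _ (fun x (v : option I -> G) => exists o,
   x = t (fun i => v (Some i)) /\ o = 1 /\ x * v None = o)).
apply: (@dfn_exists _ _ (fun o (v : option (option I) -> G) =>
   v None = t (fun i => v (Some (Some i))) /\ o = 1 /\ v None * v (Some None) = o)).
pose f (y : option (option (option I))) (o : option I) :=
  if o is Some i then Some (Some (Some i)) else y.
have ht' := dfn_var (f (Some None)) ht.
by apply: dfn_and => //; apply: dfn_and; [exact: dterm_1|exact: dfn_mul].
Qed.

Lemma dterm_comm A I (s t : (I -> G) -> G) :
  dterm A s -> dterm A t -> dterm A (fun v => [~ s v, t v]).
Proof.
move=> hs ht; rewrite /commg /conjg.
by do ?[apply: dterm_mul => //|apply: dterm_inv => //].
Qed.

Lemma dterm_exp A I (t : (I -> G) -> G) e : dterm A t -> dterm A (fun v => t v ^+ e).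
Proof.
move=> ht; elim: e => [|e IH]; first exact: dterm_1.
have -> : (fun v => t v ^+ e.+1) = (fun v => t v * t v ^+ e).
  by apply/funext => v; rewrite expgS.
exact: dterm_mul.
Qed.

Lemma dfn_eq_term A I (s t : (I -> G) -> G) :
  dterm A s -> dterm A t -> dfn A (fun v => s v = t v).
Proof.
move=> hs ht; apply: (@dfn_ext _ _ (fun v => exists x, x = s v /\ x = t v)).
  by move=> v; split=> [[x [-> ->]]|<-] //; exists (s v).
by apply: (@dfn_exists _ _ (fun x v => x = s v /\ x = t v)); exact: dfn_and.
Qed.

End DefinableRelations.

(** * Coverings by finitely many translates *)

Section Covers.
Variable G : groupType.
Implicit Types (K S T : set G) (x y g : G) (N n : nat).

Lemma commMg x y z : [~ x * y, z] = [~ x, z] ^ y * [~ y, z].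
Proof. by rewrite /commg /conjg !gnorm. Qed.

Lemma commgM x y z : [~ x, y * z] = [~ x, z] * [~ x, y] ^ z.
Proof. by rewrite /commg /conjg !gnorm. Qed.

Lemma commVg x y : [~ x^-1, y] = ([~ x, y]^-1) ^ x^-1.
Proof. by rewrite /commg /conjg !gnorm. Qed.

Lemma commgV x y : [~ x, y^-1] = ([~ x, y]^-1) ^ y^-1.
Proof. by rewrite /commg /conjg !gnorm. Qed.

(** The closure conditions of [subgroup], for membership in Prop *)
Definition is_group K :=
  [/\ K 1, forall x y, K x -> K y -> K (x * y) & forall x, K x -> K x^-1].

Lemma is_group_subgroup K : is_group K -> subgroup K.
Proof.
move=> [K1 KM KV]; split; first exact/mem_set.
by move=> x y /set_mem Kx /set_mem Ky; apply/mem_set/KM => //; exact: KV.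
Qed.

Lemma is_groupT : is_group setT. Proof. by []. Qed.

Lemma group_exp K x n : is_group K -> K x -> K (x ^+ n).
Proof.
by case=> K1 KM KV Kx; elim: n => [|n IH]; rewrite ?expg0 // expgS; apply: (KM).
Qed.

Lemma group_conj K x y : is_group K -> K x -> K y -> K (x ^ y).
Proof. by move=> [K1 KM KV] Kx Ky; apply: (KM); [exact: KV|exact: KM]. Qed.

Lemma group_comm K x y : is_group K -> K x -> K y -> K [~ x, y].
Proof.
by move=> gK Kx Ky; have [K1 KM KV] := gK; apply: (KM); [exact: KV|exact: group_conj].
Qed.

(** K is contained in the union of N + 1 right translates of S. For subgroups this says
    that the index is finite, and unlike the index it makes sense, with a bound, for
    the definable pieces of a subgroup. *)
Definition covered K S N := exists g : 'I_N.+1 -> G, forall y, K y -> exists j, S (y / g j).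

Definition quotients S : set G := [set s / t | s in S & t in S].

Lemma covered_fin (J : finType) (g : J -> G) K S :
  (forall y, K y -> exists j, S (y / g j)) -> covered K S #|J|.
Proof.
move=> h; exists (fun i => nth 1 (map g (enum J)) i) => y /h[j Sj].
have ij : index j (enum J) < #|J|.+1 by rewrite ltnS cardE index_size.
exists (Ordinal ij) => /=.
by rewrite (nth_map j) ?nth_index ?index_mem ?mem_enum.
Qed.

Lemma covered_sub K S T N n :
  (forall y, K y -> forall g, S (y / g) -> T (y / g)) -> N <= n ->
  covered K S N -> covered K T n.
Proof.
move=> ST le [g hg]; exists (fun j => g (inord j)) => y Ky.
have [j Sj] := hg y Ky; have jn : j < n.+1 by apply: leq_trans (ltn_ord j) _.
by exists (Ordinal jn); apply: ST => //=; rewrite inord_val.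
Qed.

(** The translates of the intersection are obtained from a common point of each
    nonempty intersection of translates; moving the centre there turns S into its
    set of quotients. *)
Lemma covered_cap K S T N n : covered K S N -> covered K T n ->
  exists g : 'I_N.+1 * 'I_n.+1 -> G, forall y, K y ->
    exists j, quotients S (y / g j) /\ quotients T (y / g j).
Proof.
move=> [g hg] [h hh].
have /choice[u hu] (j : 'I_N.+1 * 'I_n.+1) : exists u,
    (exists v, S (v / g j.1) /\ T (v / h j.2)) -> S (u / g j.1) /\ T (u / h j.2).
  have [[u [Su Tu]]|N0] := EM (exists u, S (u / g j.1) /\ T (u / h j.2)); first by exists u.
  by exists 1 => /N0.
exists u => y Ky.
have [j Sj] := hg y Ky; have [l Tl] := hh y Ky.
have [|Su Tu] := hu (j, l); first by exists y.
exists (j, l); split.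
  by exists (y / g j) => //; exists (u (j, l) / g j); rewrite // invgF mulgA mulgVK.
by exists (y / h l) => //; exists (u (j, l) / h l); rewrite // invgF mulgA mulgVK.
Qed.

(** Replacing the translating elements by elements of K costs a quotient. *)
Lemma covered_in K S N : is_group K -> covered K S N ->
  exists2 g : 'I_N.+1 -> G, forall j, K (g j) &
    forall y, K y -> exists j, K (y / g j) /\ quotients S (y / g j).
Proof.
move=> [K1 KM KV] [g hg].
have /choice[u hu] j : exists u, K u /\ ((exists2 u, K u & S (u / g j)) -> S (u / g j)).
  have [[u Ku Su]|N0] := EM (exists2 u, K u & S (u / g j)); first by exists u.
  by exists 1; split=> // /N0.
exists u => [j|y Ky]; first by have [] := hu j.
have [j Sj] := hg y Ky; exists j; have [Ku /(_ (ex_intro2 _ _ y Ky Sj)) Su] := hu j.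
split; first by apply/KM/KV.
by exists (y / g j) => //; exists (u j / g j); rewrite // invgF mulgA mulgVK.
Qed.

(** Pigeonhole: two of the powers 1, y, ..., y^(N+1) lie in the same translate. *)
Lemma covered_power K S N y : is_group K -> covered K S N -> K y ->
  exists k, [/\ 0 < k, k <= N.+1 & quotients S (y ^+ k)].
Proof.
move=> gK [g hg] Ky.
have /choice[j hj] (i : 'I_N.+2) : exists j, S (y ^+ i / g j) by apply: (hg); exact: group_exp.
have /injectivePn[a [b ab eab]] : ~~ injectiveb j.
  by apply/negP => /injectiveP/leq_card; rewrite !card_ord ltnn.
wlog lt : a b ab eab / a < b.
  move=> W; case: (ltngtP a b) => [|l|/val_inj e]; first exact: W.
    by apply: (W b a) => //; rewrite eq_sym.
  by rewrite e eqxx in ab.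
exists (b - a); split; rewrite ?subn_gt0 //.
  by rewrite (leq_trans (leq_subr _ _)) // -ltnS.
exists (y ^+ b / g (j b)) => //; exists (y ^+ a / g (j a)) => //.
by rewrite eab invgF mulgA mulgVK expgnFr // ltnW.
Qed.

Lemma finite_indexP K C : is_group K -> is_group C -> C `<=` K ->
  finite_index C K <-> exists N, covered K C N.
Proof.
move=> gK [C1 CM CV] CK; split.
  move=> /finite_seqP[s hs].
  have /choice[r hr] (X : set G) : exists g, X \in s -> X = right_coset C g.
    have [Xs|Xs] := boolP (X \in s); last by exists 1.
    have : [set` s] X by [].
    by rewrite -hs => -[g _ <-]; exists g.
  exists #|'I_(size s)|; apply: (@covered_fin 'I_(size s) (fun j => r (nth setT s j))) => y Ky.
  have ys : right_coset C y \in s.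
    suff : [set` s] (right_coset C y) by [].
    by rewrite -hs; exists y.
  have ix : index (right_coset C y) s < size s by rewrite index_mem.
  exists (Ordinal ix) => /=; rewrite nth_index //.
  have : right_coset C y y by exists 1; rewrite ?mul1g.
  by rewrite {1}(hr _ ys) => -[h Ch e]; rewrite -{1}e mulgK.
move=> [N /(covered_in gK)[g Kg hg]].
have sub : [set right_coset C y | y in K] `<=` [set right_coset C (g j) | j in [set: 'I_N.+1]].
  move=> _ [y Ky <-]; have [j [_ [s Cs [t Ct e]]]] := hg y Ky; exists j => //.
  have Cst : C (y / g j) by rewrite -e; apply/CM/CV.
  apply/seteqP; split=> _ [h Ch <-].
    exists (h * (y / g j)^-1); first by apply/CM/CV.
    by rewrite invgF mulgA mulgVK.
  by exists (h * (y / g j)); [apply: CM|rewrite mulgA mulgVK].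
by apply: sub_finite_set sub _; apply: finite_image; exact: finite_finset.
Qed.

End Covers.

(** * Filtrations *)

Section Filtrations.
Variable G : groupType.
Implicit Types (K S T A : set G) (x y g : G) (N n : nat) (F : nat -> set G).

(** An increasing chain of sets whose union is a normal subgroup, with a uniform bound
    on the stage at which products appear *)
Record filtration K F : Prop := Filtration {
  filt1 : F 0 1;
  filtS : forall N, F N `<=` F N.+1;
  filtV : forall N x, F N x -> F N x^-1;
  filtJ : forall N x g, K g -> F N x -> F N (x ^ g);
  filtM : forall N, exists n, forall x y, F N x -> F N y -> F n (x * y) }.

Definition filt_union F : set G := [set x | exists N, F N x].

(** The stages of FC_K of the union of F: the finite index and the stage of the
    commutators are bounded by the same N. *)
Definition next_filt K F N : set G :=
  [set x | K x /\ covered K (centralizer_mod K (F N) x) N].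

Lemma filt_leq K F N n : filtration K F -> N <= n -> F N `<=` F n.
Proof.
move=> hF; elim: n => [|n IH]; first by rewrite leqn0 => /eqP->.
rewrite leq_eqVlt => /orP[/eqP-> //|/IH h] x Fx; exact/(filtS hF)/h.
Qed.

Lemma filt_in1 K F N : filtration K F -> F N 1.
Proof. by move=> hF; apply: (filt_leq hF (leq0n N)); exact: filt1 hF. Qed.

Definition normal_in K A := is_group A /\ forall x g, K g -> A x -> A (x ^ g).

Lemma const_filtration K A : normal_in K A -> filtration K (fun=> A).
Proof.
move=> [[A1 AM AV] AJ]; by split=> // _ x.
Qed.

Lemma filt_union_normal K F : filtration K F -> normal_in K (filt_union F).
Proof.
move=> hF; split; first split.
- by exists 0; exact: filt1 hF.
- move=> x y [N Nx] [n ny]; have [k hk] := filtM hF (maxn N n); exists k.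
  exact: hk (filt_leq hF (leq_maxl N n) Nx) (filt_leq hF (leq_maxr N n) ny).
- by move=> x [N Nx]; exists N; exact: filtV hF _ _ Nx.
- by move=> x g Kg [N Nx]; exists N; exact: (filtJ hF).
Qed.

Lemma centralizer_quotients K F N : is_group K -> filtration K F ->
  exists n, forall x, quotients (centralizer_mod K (F N) x) `<=` centralizer_mod K (F n) x.
Proof.
move=> [K1 KM KV] hF; have [n hn] := filtM hF N; exists n => x.
move=> _ [s [Ks Fs] [t [Kt Ft] <-]]; split; first by apply/KM/KV.
rewrite commMg commVg; apply: hn; apply: (filtJ hF) => //; try exact: KV.
exact: filtV hF _ _ Ft.
Qed.

Definition automorphism (f : G -> G) := {morph f : x y / x * y} /\ bijective f.

Definition stable (f : G -> G) S := forall x, S (f x) <-> S x.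

Lemma aut1 f : automorphism f -> f 1 = 1.
Proof. by move=> [fM _]; apply: (mulgI (f 1)); rewrite -fM !mulg1. Qed.

Lemma autM_comm f x y : automorphism f -> f [~ x, y] = [~ f x, f y].
Proof.
move=> af; have [fM _] := af; have f1 := aut1 af.
have fV z : f z^-1 = (f z)^-1 by apply/esym/mulg1_eq; rewrite -fM mulgV.
by rewrite /commg /conjg !fM !fV.
Qed.

Lemma autV f x : automorphism f -> f x^-1 = (f x)^-1.
Proof.
move=> af; have [fM _] := af; have f1 := aut1 af.
by apply/esym/mulg1_eq; rewrite -fM mulgV.
Qed.

Lemma aut_conj h : automorphism (conjg^~ h).
Proof.
split=> [x y|]; first exact: conjMg.
by exists (conjg^~ h^-1) => x; rewrite ?conjgK ?conjgKV.
Qed.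

(** Conjugations by elements of K are covered as well, which gives normality. *)
Lemma next_stable K F N f : automorphism f -> stable f K ->
  stable f (F N) -> stable f (next_filt K F N).
Proof.
move=> af fK fF x; have [fM [f' ff' f'f]] := af.
have fC y z : centralizer_mod K (F N) (f y) (f z) <-> centralizer_mod K (F N) y z.
  by rewrite /centralizer_mod /= -autM_comm // fF fK.
rewrite /next_filt /= fK; split=> -[Kx [g hg]]; split=> //.
  exists (f' \o g) => y /fK/hg[j] /=.
  by rewrite -{1}(f'f (g j)) -autV // -fM fC; exists j.
exists (f \o g) => y; rewrite -(f'f y) => /fK/hg[j].
by rewrite -fC fM autV //; exists j.
Qed.

(** Only products need an argument: [g, xy] = [g, y] [g, x]^y, so the quotients of
    elements centralizing x and y modulo F centralize xy, and [covered_cap] covers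
    K by translates of such quotients. *)
Lemma next_filtration K F : is_group K -> filtration K F -> filtration K (next_filt K F).
Proof.
move=> gK hF; have [K1 KM KV] := gK; split.
- split=> //; exists (fun=> 1) => y Ky; exists ord0.
  by rewrite divg1; split; rewrite ?comm1g ?commg1 //; exact: filt1 hF.
- move=> N x [Kx cx]; split=> //; apply: covered_sub cx => // y Ky g [Kg Fg].
  by split=> //; exact: filtS hF _ _ Fg.
- move=> N x [Kx cx]; split; first exact: KV.
  apply: covered_sub (leqnn _) cx => y Ky g [Kg Fg]; split=> //.
  by rewrite commgV; apply: (filtJ hF); [exact: KV|exact: filtV hF _ _ Fg].
- move=> N x h Kh nx.
  have sc A : (forall x g, K g -> A x -> A (x ^ g)) -> stable (conjg^~ h) A.
    move=> AJ z; split; last exact: AJ.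
    by move=> /(AJ _ h^-1 (KV _ Kh)); rewrite conjgK.
  apply/(next_stable (aut_conj h)); last exact: nx.
    by apply: sc => z g Kg Kz; exact: group_conj.
  by apply: sc => z g Kg; exact: (filtJ hF).
move=> N; have [n hn] := centralizer_quotients N gK hF; have [k hk] := filtM hF n.
exists (maxn k #|{: 'I_N.+1 * 'I_N.+1}|) => x y [Kx cx] [Ky cy]; split; first exact: KM.
have [g hg] := covered_cap cx cy.
apply: covered_sub (leq_maxr k _) (covered_fin (S := fun z =>
  centralizer_mod K (F n) x z /\ centralizer_mod K (F n) y z) (g := g) _).
  move=> z Kz u [[Kzu Fx] [_ Fy]]; split=> //; rewrite commgM.
  by apply: (filt_leq hF (leq_maxl k _)); apply: hk => //; exact: (filtJ hF).
by move=> z Kz; have [j [/hn hx /hn hy]] := hg z Kz; exists j.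
Qed.

Lemma centralizer_sub K A x : centralizer_mod K A x `<=` K.
Proof. by move=> g []. Qed.

Lemma centralizer_group K A x : is_group K -> normal_in K A ->
  is_group (centralizer_mod K A x).
Proof.
move=> [K1 KM KV] [[A1 AM AV] AJ]; split.
- by split=> //; rewrite comm1g.
- move=> g h [Kg Ag] [Kh Ah]; split; first exact: KM.
  by rewrite commMg; apply: (AM) => //; exact: AJ.
- move=> g [Kg Ag]; split; first exact: KV.
  by rewrite commVg; apply: (AJ); [exact: KV|exact: AV].
Qed.

(** FC_K(K/A) is the union of the stages above the constant filtration A, so that
    it is a normal subgroup by the general theory of filtrations. *)
Lemma FC_mod_filt K A : is_group K -> normal_in K A ->
  FC_mod K A = filt_union (next_filt K (fun=> A)).
Proof.
move=> gK nA; have ix x := finite_indexP gK (centralizer_group x gK nA) (@centralizer_sub K A x).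
apply/seteqP; split=> x; first by move=> [Kx /ix[N cN]]; exists N.
by move=> [N [Kx cN]]; split=> //; apply/ix; exists N.
Qed.

Lemma FC_series_normal K i : is_group K -> normal_in K (FC_series K i).
Proof.
move=> gK; elim: i => [|i IH] /=.
  split; first split=> // [x y -> ->|x ->]; rewrite ?mulg1 ?invg1 //.
  by move=> x g _ ->; rewrite conj1g.
by rewrite FC_mod_filt //; exact/filt_union_normal/next_filtration/const_filtration.
Qed.

(** [FC_filt i] approximates FC_i(G) from inside; all indices involved are bounded
    by N, so that each stage is definable when the group is. *)
Fixpoint FC_filt (i : nat) : nat -> set G :=
  if i is i'.+1 then next_filt setT (FC_filt i') else fun=> [set 1].

Lemma FC_filtration i : filtration setT (FC_filt i).
Proof.
elim: i => [|i IH] /=; last exact: next_filtration.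
apply: const_filtration; exact: (FC_series_normal 0 (@is_groupT G)).
Qed.

Lemma FC_filt_stable f i N : automorphism f -> stable f (FC_filt i N).
Proof.
move=> af; elim: i N => [|i IH] N /=; last exact: next_stable.
have [fM [f' ff' _]] := af.
have f1 := aut1 af.
by move=> x; split=> [/= e|->//]; rewrite -(ff' x) e -f1 ff'.
Qed.

(** The covering elements can be chosen in K by [covered_in], so that indices in G
    bound indices in K. *)
Lemma FC_filt_series K i : is_group K ->
  K `&` filt_union (FC_filt i) `<=` FC_series K i.
Proof.
move=> gK; have [K1 KM KV] := gK; elim: i => [|i IH] x [Kx [N]] //= [_ cx].
have nA := FC_series_normal i gK; split=> //.
apply/(finite_indexP gK (centralizer_group x gK nA) (@centralizer_sub K _ x)); exists N.
have [n hn] := centralizer_quotients N (@is_groupT G) (FC_filtration i).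
have cK : covered K (centralizer_mod setT (FC_filt i N) x) N.
  by have [g hg] := cx; exists g => y _; exact: hg.
have [g _ hg] := covered_in gK cK; exists g => y /hg[j [Kj /hn[_ Fj]]].
by exists j; split=> //; apply: IH; split; [exact: group_comm|exists n].
Qed.

End Filtrations.

(** * Saturation for definable relations on the group *)

Section Saturation.
Variables (L : language) (M : structure L) (G : groupType) (m : nat).
Variable c : G -> 'I_m -> M.
Hypothesis Gdef : definable_group c.
Hypothesis Msat : aleph1_saturated M.

(** A finite set of formulas, on whose type there is no decidable equality, as a
    finite sequence *)
Lemma finite_set_enum (T : Type) (x0 : T) (F : set T) : finite_set F ->
  exists n (e : nat -> T), (forall k, k < n -> F (e k)) /\
    forall x, F x -> exists2 k, k < n & e k = x.
Proof.
move=> /finite_setP[n /card_set_bijP[f [fF finj fsurj]]]; exists n.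
have /choice[e he] (k : nat) : exists x, k < n -> F x /\ f x = k.
  have [kn|_] := boolP (k < n); last by exists x0.
  by have [x Fx e] := fsurj k kn; exists x.
exists e; split=> [k /he[]//|x Fx]; have fx : f x < n by exact: fF.
exists (f x) => //; have [Fe ee] := he _ fx.
by apply: finj => //; rewrite inE.
Qed.

(** Saturation for relations on G: the formulas are relativized to coordinates of
    elements of G ([dfn_exact]), so that a realization comes from a family of
    elements of G. *)
Lemma saturated_dfn (A : set M) (J : finType) (S : set ((J -> G) -> Prop)) :
  countable A -> (forall P, S P -> dfn c A P) ->
  (forall n (P : nat -> (J -> G) -> Prop), (forall k, k < n -> S (P k)) ->
     exists v, forall k, k < n -> P k v) ->
  exists v, forall P, S P -> P v.
Proof.
move=> cA Sdfn fin.
have [[P0 SP0]|S0] := EM (exists P, S P); last first.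
  have [v _] := fin 0 (fun _ _ => True) (fun k h => ltac:(by [])).
  by exists v => P SP; case: S0; exists P.
pose Q := (J * 'I_m)%type; pose K := #|{: Q}|.
pose co (v : J -> G) (i : 'I_K) : M := let q := enum_val i in c (v q.1) q.2.
have co_inj : injective co.
  move=> v w e; apply/funext => j; apply: (c_inj Gdef); apply/funext => l.
  have := congr1 (fun f => f (enum_rank ((j, l) : Q))) e.
  by rewrite /co enum_rankK.
have form P : S P -> exists p : formula_over A 'I_K,
    forall w, sat_over p w <-> exists2 v, P v & w = co v.
  move=> /Sdfn/(dfn_exact Gdef)[p hp].
  have [|q hq] := @sat_over_transport L M _ A A _ _
      (fun (w : 'I_K -> M) (q : Q) => w (enum_rank q)) id p.
    by move=> [q|a]; [exists (inl (enum_rank q))|exists (inr a)].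
  exists q => w; rewrite hq hp; split=> -[v Pv ew]; exists v => //.
    by apply/funext => i; rewrite /co -(congr1 (fun f => f (enum_val i)) ew) enum_valK.
  by apply/funext => q'; rewrite ew /co enum_rankK.
pose T : set (formula_over A 'I_K) := [set p | exists2 P, S P &
  forall w, sat_over p w <-> exists2 v, P v & w = co v].
have [F finF FT|w hw] := Msat (S := T) cA.
  have [n [e [eF Fe]]] := finite_set_enum (Falsum L _) finF.
  have /choice[P hP] (k : nat) : exists P, k < n ->
      S P /\ forall w, sat_over (e k) w <-> exists2 v, P v & w = co v.
    have [kn|_] := boolP (k < n); last by exists P0.
    by have [P SP eP] := FT _ (eF _ kn); exists P.
  have [v hv] := fin n P (fun k kn => (hP k kn).1).
  exists (co v) => p /Fe[k kn <-]; have [_ ->] := hP k kn.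
  by exists v => //; exact: hv.
have [p0 hp0] := form _ SP0.
have [|v _ ew] := (hp0 w).1; first by apply: hw; exists P0.
exists v => P SP; have [p hp] := form _ SP.
have [|v' Pv' ew'] := (hp w).1; first by apply: hw; exists P.
by move: ew; rewrite ew' => /co_inj <-.
Qed.

(** Compactness: the negations of an increasing family of 0-definable relations
    covering everything are not jointly realized. *)
Lemma saturated_uniform (J : finType) (Q : nat -> (J -> G) -> Prop) :
  (forall N, dfn c set0 (Q N)) -> (forall N v, Q N v -> Q N.+1 v) ->
  (forall v, exists N, Q N v) -> exists N, forall v, Q N v.
Proof.
move=> Qdfn QS Qex; apply: contrapT => nQ.
have QN v N n : N <= n -> Q N v -> Q n v.
  elim: n => [|n IH]; first by rewrite leqn0 => /eqP->.
  by rewrite leq_eqVlt => /orP[/eqP-> //|/IH h /h/QS].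
have [||| v hv] := @saturated_dfn set0 J [set P | exists N, P = fun v => ~ Q N v].
- exact: countable0.
- by move=> _ [N ->]; exact/dfn_not/Qdfn.
- move=> n P hP; have /choice[N hN] k : exists N, k < n -> P k = fun v => ~ Q N v.
    have [/hP[N ->]|_] := boolP (k < n); first by exists N.
    by exists 0.
  have /existsNP[v nv] : ~ forall v, Q (\max_(k < n) N k) v.
    by move=> h; apply: nQ; exists (\max_(k < n) N k).
  exists v => k kn; rewrite hN // => /(QN v) h; apply: nv; apply: h.
  exact: (leq_bigmax (Ordinal kn)).
have [N /(hv (fun v => ~ Q N v))] := Qex v.
by apply; exists N.
Qed.

End Saturation.

(** * Indiscernible sequences and the S1 property *)

Section Sequences.
Variables (T : Type) (next : seq T -> T).

(** Recursive construction of a sequence whose next term may depend on all the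
    previous ones *)
Fixpoint history n : seq T := if n is k.+1 then rcons (history k) (next (history k)) else [::].

Definition unfold_seq n := next (history n).

Lemma size_history n : size (history n) = n.
Proof. by elim: n => //= k IH; rewrite size_rcons IH. Qed.

Lemma history_nth x n i : i < n -> nth x (history n) i = unfold_seq i.
Proof.
elim: n => // n IH; rewrite ltnS leq_eqVlt /= nth_rcons size_history => /orP[/eqP->|lt].
  by rewrite ltnn eqxx.
by rewrite lt IH.
Qed.

End Sequences.

Section Coheir.
Variables (L : language) (M : structure L) (G : groupType) (m : nat).
Variable c : G -> 'I_m -> M.
Hypothesis Gdef : definable_group c.
Hypothesis Msat : aleph1_saturated M.
Variables (A : set M) (h : nat -> G) (U : set_system nat).
Hypothesis cA : countable A.
Hypothesis hA : forall i l, A (c (h i) l).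
Hypothesis UU : UltraFilter U.

Let B (s : seq G) : set M := A `|` [set x | exists i l, (i < size s)%N /\ x = c (nth 1 s i) l].

Lemma countable_params s : countable (B s).
Proof.
rewrite /B -bigcup2E; apply: bigcup_countable => // -[|[|i]] _ //=.
apply: (@sub_countable _ _ _ [set c (nth 1 s q.1) q.2 | q in [set: nat * 'I_m]]).
  by apply: subset_card_le => x [i [l [_ ->]]]; exists (i, l).
by apply: sub_countable (card_image_le _ _) _; exact: countableP.
Qed.

(** The average type of h along U is finitely satisfiable in h, and so saturation
    realizes it over countably many parameters. *)
Lemma average_realized s : exists x, forall P : G -> Prop,
  dfn c (B s) (fun v : unit -> G => P (v tt)) -> (P x <-> U [set i | P (h i)]).
Proof.
pose S : set ((unit -> G) -> Prop) := [set R | exists P : G -> Prop,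
  [/\ R = fun v => P (v tt), dfn c (B s) R & U [set i | P (h i)]]].
have [||n R SR|v hv] := @saturated_dfn L M G m c Gdef Msat (B s) _ S.
- exact: countable_params.
- by move=> R [P []].
- have UR : U [set i | forall k, k < n -> R k (fun=> h i)].
    elim: n SR => [|n IH] SR; first by rewrite (_ : mkset _ = setT); [exact: filterT|apply/seteqP].
    have [P [eR _ UP]] := SR n (leqnn _).
    have UI := IH (fun k kn => SR k (ltnW kn)).
    apply: filterS (filterI UP UI) => i [/= Pi Ii] k.
    by rewrite ltnS leq_eqVlt => /orP[/eqP->|/Ii //]; rewrite eR.
  by have [i hi] := filter_ex UR; exists (fun=> h i).
exists (v tt) => P Pdfn; split=> [Pv|UP].
  have [//|UC] := in_ultra_setVsetC [set i | P (h i)] UU.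
  case: (hv (fun v => ~ P (v tt))) => //; exists (fun x => ~ P x).
  by split=> //; exact: dfn_not.
by apply: (hv (fun v => P (v tt))); exists P.
Qed.

(** A realization of the average type of h over the base parameters A and the terms
    of the list *)
Definition coheir_next := projT1 (choice average_realized).
Definition coheir := unfold_seq coheir_next.

Lemma coheirP n (P : G -> Prop) :
  dfn c (B (history coheir_next n)) (fun v : unit -> G => P (v tt)) ->
  (P (coheir n) <-> U [set i | P (h i)]).
Proof. exact: (projT2 (choice average_realized)). Qed.

Lemma coheir_params n i l : i < n -> B (history coheir_next n) (c (coheir i) l).
Proof.
by move=> lt; right; exists i, l; rewrite size_history history_nth.
Qed.

Lemma base_params s : A `<=` B s. Proof. by move=> x; left. Qed.

(** By induction on the length, the truth of P at an increasing subsequence is decided by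
    its last term, where it means truth at h_i for U-almost all i; with h_i as
    a parameter, this concerns a shorter subsequence. The coordinates of the h_i
    belong to A, hence the induction hypothesis applies to P with h_i plugged in. *)
Lemma coheir_same_type r (P : ('I_r -> G) -> Prop) (s t : 'I_r -> nat) :
  dfn c A P -> (forall i j : 'I_r, i < j -> s i < s j) ->
  (forall i j : 'I_r, i < j -> t i < t j) ->
  (P (coheir \o s) <-> P (coheir \o t)).
Proof.
elim: r P s t => [|r IH] P s t hP hs ht.
  by rewrite (_ : coheir \o s = coheir \o t) //; apply/funext => -[].
pose snoc (u : 'I_r -> G) (x : G) (i : 'I_r.+1) := if unlift ord_max i is Some j then u j else x.
have lastP (u : 'I_r.+1 -> nat) : (forall i j : 'I_r.+1, i < j -> u i < u j) ->
    P (coheir \o u) <-> U [set i | P (snoc (coheir \o u \o lift ord_max) (h i))].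
  move=> hu; rewrite -(@coheirP (u ord_max) (fun x => P (snoc (coheir \o u \o lift ord_max) x))).
    rewrite (_ : snoc _ _ = coheir \o u) //.
    by apply/funext => i; rewrite /snoc; case: unliftP => [j ->|->].
  pose f (i : 'I_r.+1) : unit + G :=
    if unlift ord_max i is Some j then inr (coheir (u (lift ord_max j))) else inl tt.
  apply: dfn_ext (dfn_subst (t := f) (@base_params _) _ hP) => [v|i g].
    by rewrite (_ : snoc _ _ = fun j => sum_fun v id (f j)) //;
       apply/funext => i; rewrite /snoc /f; case: unlift.
  rewrite /f; case: unliftP => // j _ [<-] l; apply: coheir_params; apply: hu.
  by rewrite lift_max.
rewrite (lastP s hs) (lastP t ht).
rewrite (_ : mkset _ = [set i | P (snoc (coheir \o t \o lift ord_max) (h i))]) //.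
apply/seteqP.
have step i : P (snoc (coheir \o s \o lift ord_max) (h i)) <->
    P (snoc (coheir \o t \o lift ord_max) (h i)).
  apply: (IH (fun u => P (snoc u (h i))) (s \o lift ord_max) (t \o lift ord_max)).
  - pose f (j : 'I_r.+1) : 'I_r + G := if unlift ord_max j is Some k then inl k else inr (h i).
    apply: dfn_ext (dfn_subst (t := f) (fun x => id) _ hP) => [v|j g].
      by rewrite (_ : snoc _ _ = fun j => sum_fun v id (f j)) //;
         apply/funext => j; rewrite /snoc /f; case: unlift.
    by rewrite /f; case: unliftP => // _ [<-] l.
  - by move=> j k jk; apply: hs; rewrite !lift_max.
  - by move=> j k jk; apply: ht; rewrite !lift_max.
by split=> i /step.
Qed.

Lemma coheir_indiscernible : indiscernible c A coheir.
Proof.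
move=> r s t ss st; apply/seteqP.
have incr (u : r.-tuple nat) : sorted ltn u -> forall i j : 'I_r, i < j -> tnth u i < tnth u j.
  move=> su i j ij; rewrite !(tnth_nth 0).
  by apply: (sorted_ltn_nth ltn_trans) => //; rewrite inE size_tuple.
have E (p : formula_over A ('I_r * 'I_m)) :
    sat_over p (fun q => c (coheir (tnth s q.1)) q.2) <->
    sat_over p (fun q => c (coheir (tnth t q.1)) q.2).
  apply: (@coheir_same_type r (fun v => sat_over p (fun q => c (v q.1) q.2))).
  - by exists p.
  - exact: incr.
  - exact: incr.
by split=> p /E.
Qed.

(** R(coheir_i, coheir_j) for i < j is R(h_l, h_k) for U-almost all k and
    then U-almost all l, where l is larger than k; this is why R is assumed
    for all pairs of distinct indices. *)
Lemma coheir_pair (R : G -> G -> Prop) :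
  (forall k, U [set j | j != k]) ->
  dfn c A (fun v : bool -> G => R (v false) (v true)) ->
  (forall i j, i != j -> R (h i) (h j)) ->
  forall i j, i < j -> R (coheir i) (coheir j).
Proof.
move=> Uinf hR hh i j ij.
apply/(@coheirP j (R (coheir i))).
  pose t (b : bool) : unit + G := if b then inl tt else inr (coheir i).
  apply: dfn_ext (dfn_subst (t := t) (@base_params _) _ hR) => [v|[] // g [<-] l] //.
  exact: coheir_params.
suff RU k : R (coheir i) (h k).
  by apply: filterS filterT => k _; exact: RU.
apply/(@coheirP i (fun x => R x (h k))).
  pose t (b : bool) : unit + G := if b then inr (h k) else inl tt.
  apply: dfn_ext (dfn_subst (t := t) (@base_params _) _ hR) => [v|[] // g [<-] l] //.
  exact: base_params.
by apply: filterS (Uinf k) => l /= lk; exact: hh.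
Qed.

End Coheir.

Section WideCover.
Variables (L : language) (M : structure L) (G : groupType) (m : nat).
Variable c : G -> 'I_m -> M.
Hypothesis Gdef : definable_group c.
Hypothesis Msat : aleph1_saturated M.
Variable mu : set (set (1.-tuple G)).
Hypothesis mu_ideal : ideal (@coords L M G m c 1) mu.
Hypothesis mu_S1 : right_translational_S1 c (ideal_on_G mu).

Lemma wide_translate X g : wide (ideal_on_G mu) X -> wide (ideal_on_G mu) (rtranslate X g).
Proof.
move=> wX Z muZ sub; apply: (wX (rtranslate Z g^-1)); first by case: mu_S1 => h _; exact: h.
by move=> x Xx; exists (x * g); [apply: sub; exists x|rewrite mulgK].
Qed.

Lemma ideal_on_G0 : ideal_on_G mu set0.
Proof.
have [[X muX] _ sub _ _] := mu_ideal; rewrite /ideal_on_G /=.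
apply: sub muX _ _ => //.
by apply: (definable_of_dfn Gdef); exact: dfn_False.
Qed.

(** If infinitely many translates of X were needed, there would be a sequence
    with disjoint translates of X, and a coheir of it would contradict S1. *)
Lemma wide_covered (A : set M) (X : set G) : countable A ->
  dfn c A (fun v : unit -> G => X (v tt)) -> wide (ideal_on_G mu) X ->
  exists N, covered setT [set z | exists s t, [/\ X s, X t & z = s^-1 * t]] N.
Proof.
move=> cA Xdfn wX; apply: contrapT => nC.
set Q := mkset _ in nC.
have /choice[next hnext] (s : seq G) : exists y, forall g, g \in s -> ~ Q (y / g).
  apply: contrapT => N; apply: nC; exists #|'I_(size s)|.
  apply: (@covered_fin _ 'I_(size s) (nth 1 s)) => y _.
  apply: contrapT => ny; apply: N; exists y => g gs Qg; apply: ny.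
  have ig : index g s < size s by rewrite index_mem.
  by exists (Ordinal ig); rewrite /= nth_index.
pose h := unfold_seq next.
pose disj x y := forall a b, X a -> X b -> a * x <> b * y.
have hlt i j : i < j -> disj (h i) (h j).
  move=> ij a b Xa Xb e; apply: (hnext (history next j) (h i)).
    by rewrite /h -(history_nth _ 1 ij) mem_nth // size_history.
  exists b, a; split=> //; change (h j / h i = b^-1 * a).
  by apply: (mulgI b); rewrite mulVKg mulgA -e mulgK.
have hne i j : i != j -> disj (h i) (h j).
  by rewrite neq_ltn => /orP[/hlt//|/hlt H] a b Xa Xb e; exact: (H b a).
(* an ultrafilter containing the cofinite sets is not principal *)
have [U [UU ooU]] := ultraFilterLemma eventually_filter.
have Uinf k : U [set j | j != k].
  by apply: ooU; exists k.+1 => // j /= kj; rewrite gtn_eqF.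
pose A' := A `|` [set c (h q.1) q.2 | q in [set: nat * 'I_m]].
have cA' : countable A'.
  rewrite /A' -bigcup2E; apply: bigcup_countable => // -[|[|i]] _ //=.
  by apply: sub_countable (card_image_le _ _) _; exact: countableP.
have hA' i l : A' (c (h i) l) by right; exists (i, l).
have AA' : A `<=` A' by move=> x; left.
pose g := coheir Gdef Msat h cA' UU.
have Xdfn' := dfn_params AA' Xdfn.
have gdisj : forall i j, i < j -> disj (g i) (g j).
  apply: coheir_pair => //.
  apply: (@dfn_forall _ _ _ _ _ Gdef _ _ (fun a (v : bool -> G) =>
    forall b, X a -> X b -> a * v false <> b * v true)).
  apply: (@dfn_forall _ _ _ _ _ Gdef _ _ (fun b (v : option bool -> G) =>
    X (v None) -> X b -> v None * v (Some false) <> b * v (Some true))).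
  apply: dfn_imp; first exact: (dfn_var (fun=> Some None) Xdfn').
  apply: dfn_imp; first exact: (dfn_var (fun=> None) Xdfn').
  apply: dfn_not; apply: (dfn_eq_term Gdef); apply: (dterm_mul Gdef); exact: dterm_var.
have [_ /(_ A' X)] := mu_S1; apply; first exact: (definable_of_dfn1 Gdef).
exists g; split; first exact: coheir_indiscernible.
- move=> i j ij; rewrite (_ : _ `&` _ = set0); first exact: ideal_on_G0.
  apply/seteqP; split=> // x [[a Xa <-] [b Xb e]].
  exact: (gdisj i j ij a b Xa Xb (esym e)).
- by move=> i; exact: wide_translate.
Qed.

End WideCover.

(** * From commuting tuples to the FC-series *)

Section Descent.
Variables (L : language) (M : structure L) (G : groupType) (m : nat).
Variable c : G -> 'I_m -> M.
Hypothesis Gdef : definable_group c.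
Hypothesis Msat : aleph1_saturated M.

Lemma FC_filt_dfn A i N : dfn c A (fun v : unit -> G => FC_filt i N (v tt)).
Proof.
elim: i N => [|i IH] N.
  exact: (dfn_eq_term Gdef (dterm_var Gdef _ _) (dterm_1 Gdef _ _)).
apply: (@dfn_ext _ _ _ _ _ _ _ (fun v : unit -> G => exists g : 'I_N.+1 -> G,
    forall y, exists j, FC_filt i N [~ y / g j, v tt])).
  move=> v; split=> [[g hg]|[_ [g hg]]].
    by split=> //; exists g => y _; have [j hj] := hg y; exists j.
  by exists g => y; have [j [_ hj]] := hg y I; exists j.
apply: (@dfn_exists_block _ _ _ _ _ Gdef _ _ _ (fun g (v : unit -> G) =>
    forall y, exists j, FC_filt i N [~ y / g j, v tt])).
apply: (@dfn_forall _ _ _ _ _ Gdef _ _ (fun y (v : 'I_N.+1 + unit -> G) =>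
    exists j, FC_filt i N [~ y / v (inl j), v (inr tt)])).
apply: dfn_exists_fin => j; apply: (dfn_term Gdef) (IH N) _.
apply: (dterm_comm Gdef); last exact: dterm_var.
by apply: (dterm_mul Gdef); [|apply: (dterm_inv Gdef)]; exact: dterm_var.
Qed.

Lemma left_commutator_dterm A I (s : seq I) :
  dterm c A (fun v => left_commutator (map v s)).
Proof.
case: s => [|i s] /=; first exact: dterm_1.
elim/last_ind: s => [|s j IH] /=; first exact: dterm_var.
have -> : (fun v : I -> G => foldl commg (v i) (map v (rcons s j))) =
    fun v => [~ foldl commg (v i) (map v s), v j].
  by apply/funext => v; rewrite map_rcons foldl_rcons.
by apply: (dterm_comm Gdef) => //; exact: dterm_var.
Qed.

Definition commutator_in k (S : set G) : set (k.-tuple G) :=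
  [set x | S (left_commutator x)].

Lemma commutator_in_dfn A k i N : dfn c A (fun v : 'I_k -> G =>
  commutator_in (k := k) (FC_filt i N) [tuple v i | i < k]).
Proof.
apply: dfn_ext (dfn_term Gdef (FC_filt_dfn A i N) (left_commutator_dterm A (enum 'I_k))) => v.
by rewrite /commutator_in /= -map_comp.
Qed.

Lemma realizations_sub k A (x : k.-tuple G) (Y : set (k.-tuple G)) :
  dfn c A (fun v : 'I_k -> G => Y [tuple v i | i < k]) -> Y x ->
  realizations (coords c (k := k)) (tp A (coords c x)) `<=` Y.
Proof.
move=> [p hp] Yx y /(_ p).
have tE (z : k.-tuple G) : [tuple tnth z i | i < k] = z.
  by apply: eq_from_tnth => i; rewrite tnth_mktuple.
have pE z : Y z <-> sat_over p (coords c z) by rewrite -{1}(tE z) hp.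
by rewrite pE; apply; apply/pE.
Qed.

Lemma left_commutator_rcons (s : seq G) y : s != [::] ->
  left_commutator (rcons s y) = [~ left_commutator s, y].
Proof. by case: s => // x s _ /=; rewrite foldl_rcons. Qed.

(** {z | [x, z] in F} is closed under inverses because F is, and so its left
    quotients are right quotients as well. *)
Lemma quotients_inv k N : exists n, forall x : G,
  [set z | exists s t, [/\ FC_filt k N [~ x, s], FC_filt k N [~ x, t] & z = s^-1 * t]]
    `<=` centralizer_mod setT (FC_filt k n) x.
Proof.
have [n hn] := centralizer_quotients N (@is_groupT G) (FC_filtration G k).
exists n => x _ [s [t [Fs Ft ->]]]; apply: hn.
have inv z : FC_filt k N [~ x, z] -> centralizer_mod setT (FC_filt k N) x z^-1.
  move=> Fz; split=> //; rewrite commVg.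
  by apply: (filtJ (FC_filtration G k)) => //; rewrite invgR.
by exists s^-1; [exact: inv|exists t^-1; [exact: inv|rewrite invgK]].
Qed.

Section Step.
Variables (mu1 : set (set (1.-tuple G))).
Hypothesis mu1_ideal : ideal (@coords L M G m c 1) mu1.
Hypothesis mu1_S1 : right_translational_S1 c (ideal_on_G mu1).

(** One coordinate is removed at the price of one step in the FC-series: for a tuple a
    given by compatibility, z such that [[a], z] lies in the k-th stage form a wide
    set, so that [a] lies in the next stage, and this is a 0-definable property of a. *)
Lemma descent i (mui : set (set (i.-tuple G))) (mui1 : set (set ((i + 1).-tuple G))) k N :
  0 < i -> compatible_ideals c mui1 mui mu1 ->
  wide mui1 (commutator_in (FC_filt k N)) ->
  exists n, wide mui (commutator_in (FC_filt k.+1 n)).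
Proof.
move=> i0 comp wY.
have [a [b [Yab wa wb]]] := comp set0 _ (countable0 _)
  (definable_of_dfn Gdef (commutator_in_dfn _ _ _ _)) wY.
set x := left_commutator a; set A := _ `|` _ in wb.
have cA : countable A.
  rewrite /A set0U; apply: sub_countable (card_image_le _ _) _; exact: countableP.
pose B : set G := [set z | FC_filt k N [~ x, z]].
have Bdfn : dfn c A (fun v : unit -> G => B (v tt)).
  (* the coordinates of a become parameters *)
  pose t (j : option 'I_i) : unit + G := if j is Some j then inr (tnth a j) else inl tt.
  have h : dfn c set0 (fun v : option 'I_i -> G =>
      FC_filt k N [~ left_commutator (map v (map Some (enum 'I_i))), v None]).
    apply: (dfn_term Gdef (FC_filt_dfn _ _ _)).
    by apply: (dterm_comm Gdef); [exact: left_commutator_dterm|exact: dterm_var].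
  apply: dfn_ext (dfn_subst (t := t) (@sub0set _ A) _ h) => [v|[j|] g //= [<-] l].
    rewrite -map_comp (_ : map _ _ = a) //.
    by rewrite -[RHS](map_tnth_enum a); apply: eq_map.
  by right; exists (j, l).
have Bb : B (thead b).
  have e : rcons a (thead b) = a ++ b.
    by case/tupleP: b {Yab wb} => y b; rewrite (tuple0 b) theadE /= cats1.
  move: Yab; rewrite /commutator_in /= -e left_commutator_rcons //.
  by rewrite -size_eq0 size_tuple -lt0n.
have wB : wide (ideal_on_G mu1) B.
  move=> Z muZ BZ; apply: (wb _ muZ) => y Hy; apply: BZ.
  apply: (@realizations_sub 1 A b [set y | B (thead y)] _ Bb y Hy).
  apply: dfn_ext (dfn_var (fun=> ord0) Bdfn) => v.
  by rewrite /thead /= tnth_mktuple.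
have [N1 cov] := wide_covered Gdef Msat mu1_ideal mu1_S1 cA Bdfn wB.
have [N2 hN2] := quotients_inv k N.
exists (maxn N1 N2) => Z muZ sub; apply: (wa _ muZ).
apply: subset_trans sub; apply: realizations_sub; first exact: commutator_in_dfn.
split=> //; apply: covered_sub cov; last exact: leq_maxl.
move=> y _ g /hN2[_ F2]; split=> //.
exact: (filt_leq (FC_filtration G k) (leq_maxr N1 N2)).
Qed.

End Step.

Lemma descent_all n (mu : forall k, set (set (k.-tuple G))) :
  0 < n -> compatible_system c n mu ->
  right_translational_S1 c (ideal_on_G (mu 1%N)) ->
  wide (mu n) [set x : n.-tuple G | left_commutator x = 1] ->
  exists N, wide (mu 1%N) (commutator_in (FC_filt n.-1 N)).
Proof.
move=> n0 [idl comp] S1 wn.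
have id1 : ideal (coords c (k := 1)) (mu 1%N) by apply: idl; rewrite n0.
suff H k : k < n -> exists N, wide (mu (n - k)) (commutator_in (FC_filt k N)).
  have [|N] := H n.-1; first by rewrite prednK.
  have -> : n - n.-1 = 1%N by rewrite -{1}(prednK n0) subSnn.
  by exists N.
elim: k => [|k IH] kn; first by rewrite subn0; exists 0.
have [N wN] := IH (ltnW kn).
have e : (n - k = n - k.+1 + 1)%N by rewrite addn1 (subnSK (ltnW kn)).
rewrite e in wN.
have i0 : 0 < n - k.+1 by rewrite subn_gt0.
have le : (n - k.+1 + 1 <= n)%N by rewrite -e leq_subr.
exact: (descent id1 S1 i0 (comp _ 1%N i0 isT le) wN).
Qed.

(** Those translating elements that belong to the union are finitely many, so they
    lie in one stage. *)
Lemma FC_union_definable i N n : covered setT (@FC_filt G i N) n ->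
  exists k, filt_union (@FC_filt G i) = FC_filt i k.
Proof.
move=> [g hg]; have hF := FC_filtration G i.
have /choice[r hr] j : exists r, filt_union (FC_filt i) (g j) -> FC_filt i r (g j).
  by have [[r hr]|h] := EM (filt_union (FC_filt i) (g j)); [exists r|exists 0].
have [[_ UM UV] _] := filt_union_normal hF.
have [k hk] := filtM hF (maxn N (\max_j r j)); exists k.
apply/seteqP; split=> x; last by exists k.
move=> Ux; have [j Fj] := hg x Logic.I.
have Ug : filt_union (FC_filt i) (g j).
  have -> : g j = (x / g j)^-1 * x by rewrite invgF mulgVK.
  by apply: (UM) => //; apply: UV; exists N.
rewrite -(mulgVK (g j) x); apply: hk.
  exact: (filt_leq hF (leq_maxl _ _)).
apply: (filt_leq hF (leq_maxr N _)); apply: (filt_leq hF (leq_bigmax j)); exact: hr.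
Qed.

Lemma wide_FC_covered i N (mu1 : set (set (1.-tuple G))) :
  ideal (@coords L M G m c 1) mu1 -> right_translational_S1 c (ideal_on_G mu1) ->
  wide mu1 (commutator_in (FC_filt i N)) ->
  exists k n, covered setT (@FC_filt G i k) n.
Proof.
move=> id1 S1 w.
have w' : wide (ideal_on_G mu1) (FC_filt i N).
  move=> Z muZ sub; apply: (w _ muZ) => x; rewrite /commutator_in /=.
  by case/tupleP: x => y x; rewrite (tuple0 x) theadE => /sub.
have [n cov] := wide_covered Gdef Msat id1 S1 (countable0 _) (FC_filt_dfn set0 i N) w'.
have hF := FC_filtration G i; have [k hk] := filtM hF N; exists k, n.
apply: covered_sub (leqnn n) cov => y _ g [s [t [Fs Ft ->]]].
by apply: hk => //; exact: (filtV hF).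
Qed.

End Descent.

(** * Generated subgroups *)

Section Generated.
Variable G : groupType.
Implicit Types (A B S P : set G) (x y z : G).

Lemma subgroup_is_group A : subgroup A -> is_group A.
Proof.
move=> [/set_mem A1 AF]; have AF' x y : A x -> A y -> A (x / y).
  by move=> Ax Ay; apply/set_mem/AF; rewrite inE.
have AV x : A x -> A x^-1 by move=> Ax; rewrite -(mul1g x^-1); exact: AF'.
by split=> // x y Ax Ay; rewrite -(invgK y); apply: AF' => //; exact: AV.
Qed.

Lemma generated_min S A : is_group A -> S `<=` A -> generated S `<=` A.
Proof. by move=> gA SA; apply: smallest_sub => //; exact: is_group_subgroup. Qed.

Lemma sub_generated S : S `<=` generated S.
Proof. exact: sub_smallest. Qed.

Lemma generated_group S : is_group (generated S).
Proof.
split=> [A [/subgroup_is_group[] //]|x y Sx Sy A [gA SA]|x Sx A [gA SA]];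
  have [_ AM AV] := subgroup_is_group gA.
  by apply: (AM); [exact: Sx|exact: Sy].
by apply: (AV); exact: Sx.
Qed.

(** The elements by which P is stable under right multiplication, together with their
    inverses, form a subgroup. *)
Lemma generated_absorb S P : P 1 ->
  (forall z x, P z -> S x -> P (z * x) /\ P (z / x)) -> generated S `<=` P.
Proof.
move=> P1 PS y Sy; pose A := [set y | forall z, P z -> P (z * y) /\ P (z / y)].
have gA : is_group A.
  split=> [z|a b Aa Ab z Pz|a Aa z Pz]; first by rewrite mulg1 divg1.
    by rewrite invgM !mulgA; split; [apply/(Ab _ _).1/(Aa _ _).1|apply/(Aa _ _).2/(Ab _ _).2].
  by rewrite invgK; have [] := Aa _ Pz.
have /(_ _ P1)[] : A y by apply: generated_min Sy => // x Sx z Pz; exact: PS.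
by rewrite mul1g.
Qed.

End Generated.

(** * The nilpotent subgroup *)

Section Nilpotent.
Variable G : groupType.
Variables (K : set G) (c e : nat).
Hypothesis gK : is_group K.
Hypothesis nK : normal_in setT K.
Implicit Types (x y z u h g : G) (i j N n : nat).

Let K1 : K 1. Proof. by case: gK. Qed.
Let KM x y : K x -> K y -> K (x * y). Proof. by case: gK => _ + _; apply. Qed.
Let KV x : K x -> K x^-1. Proof. by case: gK => _ _; apply. Qed.

(** The terms U_j of the upper central series of K relative to the e-th powers:
    [h, x_1^e, ..., x_j^e] = 1 for all x_i in K *)
Fixpoint power_centre e j : set G :=
  if j is j'.+1 then [set h | K h /\ forall x, K x -> power_centre e j' [~ h, x ^+ e]]
  else [set 1].

Lemma power_centre_dvd d k j : power_centre d j `<=` power_centre (d * k) j.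
Proof.
elim: j => [|j IH] // h [Kh hh]; split=> // x Kx.
by apply: IH; rewrite mulnC expgnA; apply: hh; exact: group_exp.
Qed.

(** Centralizers modulo a stage F n are not subgroups: each product moves to a later
    stage, and a bound on the exponent bounds the final stage. *)
Lemma centralizer_exp F T n : filtration setT F -> exists n', forall t x z,
  t <= T -> centralizer_mod setT (F n) x z -> centralizer_mod setT (F n') x (z ^+ t).
Proof.
move=> hF; elim: T => [|T [k hk]].
  exists n => t x z; rewrite leqn0 => /eqP-> _; split=> //.
  by rewrite comm1g; exact: filt_in1 hF.
have [l hl] := filtM hF (maxn n k).
exists (maxn k l) => t x z; rewrite leq_eqVlt => /orP[/eqP->|/hk h] cz; split=> //.
  rewrite expgS commMg; apply: (filt_leq hF (leq_maxr k l)); apply: hl.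
    by apply: (filtJ hF) => //; apply: (filt_leq hF (leq_maxl n k)); case: cz.
  by apply: (filt_leq hF (leq_maxr n k)); case: (hk _ _ _ (leqnn T) cz).
by apply: (filt_leq hF (leq_maxl k l)); case: (h _ _ cz).
Qed.

(** All powers y^d with the factor (N + 1)! centralize x modulo some stage by
    [covered_power]; the exponent obtained for that stage is a further factor. *)
Lemma FC_filt_power j N : exists2 d, 0 < d & K `&` FC_filt j N `<=` power_centre d j.
Proof.
elim: j N => [|j IH] N; first by exists 1%N => // x [].
have hF := FC_filtration G j.
have [n hn] := centralizer_quotients N (@is_groupT G) hF.
have [n' hn'] := centralizer_exp (N.+1)`! n hF.
have [d d0 hd] := IH n'.
(* any return time k <= N + 1 divides (N + 1)!, so one exponent serves all y *)
exists (d * (N.+1)`!)%N; first by rewrite muln_gt0 d0 fact_gt0.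
move=> x [Kx [_ cx]]; split=> // y Ky; apply: power_centre_dvd; apply: hd.
split; first by apply: group_comm => //; exact: group_exp.
have [k [k0 kN /hn qk]] := covered_power (is_groupT G) cx (I : setT (y ^+ d)).
rewrite expgnA -(divnK (dvdn_fact (n := N.+1) (m := k) _)) ?k0 // mulnC expgnA.
rewrite -invgR; apply: (filtV hF); apply: (hn' _ _ _ _ qk).2.
exact: leq_div.
Qed.

Lemma power_centre_normal j : normal_in setT (power_centre e j).
Proof.
elim: j => [|j [[U1 UM UV] UJ]].
  by split=> [|x g _ ->]; [split=> // [x y -> ->|x ->]; rewrite ?mulg1 ?invg1|rewrite conj1g].
have [_ KJ] := nK.
split; first split.
- by split=> // x _; rewrite comm1g.
- move=> h k [Kh hh] [Kk hk]; split; first exact: KM.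
  by move=> x Kx; rewrite commMg; apply: UM; [apply: UJ => //; exact: hh|exact: hk].
- move=> h [Kh hh]; split; first exact: KV.
  by move=> x Kx; rewrite commVg; apply: UJ => //; apply: UV; exact: hh.
- move=> h g _ [Kh hh]; split; first exact: KJ.
  move=> x Kx; rewrite -(conjgKV g x) -conjXg -conjRg; apply: UJ => //.
  by apply: hh; exact: KJ.
Qed.

Lemma power_centre_stable f j : automorphism f -> stable f K -> stable f (power_centre e j).
Proof.
move=> af fK; have [fM [f' ff' f'f]] := af.
have f1 := aut1 af.
have fX x n : f (x ^+ n) = f x ^+ n.
  by elim: n => [|n IH]; rewrite ?expg0 // !expgS fM IH.
elim: j => [|j IH] h /=; first by split=> [/= E|->//]; rewrite -(ff' h) E -f1 ff'.
rewrite fK; split=> -[Kh hh]; split=> // x Kx.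
  by rewrite -IH autM_comm // fX; apply: hh; rewrite fK.
rewrite -(f'f x) -fX -autM_comm // IH; apply: hh.
by rewrite -fK f'f.
Qed.

(** The common centralizer in K of the quotients U_(j+1) / U_j, j < c. It is
    definable, whereas the group generated by the e-th powers, which it contains, need
    not be. *)
Definition nil_part : set G := [set h | K h /\
  forall j u, j < c -> power_centre e j.+1 u -> power_centre e j [~ u, h]].

Lemma nil_part_normal : normal_in setT nil_part.
Proof.
have nU j := power_centre_normal j; have [_ KJ] := nK.
split; first split.
- by split=> // j u _ _; rewrite commg1; case: (nU j) => -[].
- move=> h k [Kh hh] [Kk hk]; split; first exact: KM.
  move=> j u jc uj; rewrite commgM; have [[U1 UM UV] UJ] := nU j.
  by apply: UM; [exact: hk|apply: UJ => //; exact: hh].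
- move=> h [Kh hh]; split; first exact: KV.
  move=> j u jc uj; rewrite commgV; have [[U1 UM UV] UJ] := nU j.
  by apply: UJ => //; apply: UV; exact: hh.
- move=> h g _ [Kh hh]; split; first exact: KJ.
  move=> j u jc uj; rewrite -(conjgKV g u) -conjRg; have [[U1 UM UV] UJ] := nU j.
  apply: UJ => //; apply: hh => //.
  by have [_ UJ'] := nU j.+1; exact: UJ'.
Qed.

Lemma nil_part_stable f : automorphism f -> stable f K -> stable f nil_part.
Proof.
move=> af fK h; have [fM [f' ff' f'f]] := af.
have fU j : stable f (power_centre e j) by exact: power_centre_stable.
rewrite /nil_part /= fK; split=> -[Kh hh]; split=> // j u jc uj.
  apply/(fU j); rewrite autM_comm //; apply: hh => //; exact/(fU j.+1).
rewrite -(f'f u) -autM_comm //; apply/(fU j); apply: hh => //.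
by apply/(fU j.+1); rewrite f'f.
Qed.

Lemma nil_part_power x : K x -> nil_part (x ^+ e).
Proof. by move=> Kx; split=> [|j u _ [_]]; [exact: group_exp|apply]. Qed.

(** The lower central series descends along U_c, ..., U_0 = 1. *)
Lemma nil_part_nilpotent : K `<=` power_centre e c ->
  exists2 k, k <= c & nilpotent_of_class nil_part k.
Proof.
move=> KU; have low j : j <= c -> lower_central nil_part j `<=` power_centre e (c - j).
  elim: j => [|j IH] jc /=; first by rewrite subn0 => h [Kh _]; exact: KU.
  have [gU _] := power_centre_normal (c - j.+1).
  apply: generated_min => // _ [x /(IH (ltnW jc)) Ux [y [_ Hy] <-]].
  by apply: Hy; rewrite subnSK // leq_subr.
have low1 j : lower_central nil_part j 1.
  case: j => [|j] /=; first by case: nil_part_normal => -[].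
  by case: (generated_group [set [~ x, y] | x in lower_central nil_part j & y in nil_part]).
have P : exists k, `[< lower_central nil_part k = [set 1] >].
  exists c; apply/asboolP/seteqP; split; last by move=> _ ->.
  by have := low c (leqnn c); rewrite subnn.
exists (ex_minn P); case: ex_minnP => k /asboolP Pk kmin.
  apply: kmin; apply/asboolP/seteqP; split; last by move=> _ ->.
  by have := low c (leqnn c); rewrite subnn.
split=> // j jk /asboolP/kmin; by rewrite leqNgt jk.
Qed.

End Nilpotent.

Section NilpotentDefinable.
Variables (L : language) (M : structure L) (G : groupType) (m : nat).
Variable c : G -> 'I_m -> M.
Hypothesis Gdef : definable_group c.
Variables (A : set M) (K : set G) (e : nat).
Hypothesis Kdef : dfn c A (fun v : unit -> G => K (v tt)).

Lemma power_centre_dfn j : dfn c A (fun v : unit -> G => power_centre K e j (v tt)).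
Proof.
elim: j => [|j IH]; first exact: (dfn_eq_term Gdef (dterm_var Gdef _ _) (dterm_1 Gdef _ _)).
apply: dfn_and => //.
apply: (@dfn_forall _ _ _ _ _ Gdef _ _ (fun x (v : unit -> G) =>
   K x -> power_centre K e j [~ v tt, x ^+ e])).
apply: dfn_imp; first exact: (dfn_var (fun=> None) Kdef).
apply: (dfn_term Gdef IH); apply: (dterm_comm Gdef); first exact: dterm_var.
by apply: (dterm_exp Gdef); exact: dterm_var.
Qed.

Lemma nil_part_dfn k : dfn c A (fun v : unit -> G => nil_part K k e (v tt)).
Proof.
apply: (@dfn_ext _ _ _ _ _ _ _ (fun v : unit -> G => K (v tt) /\ forall j : 'I_k, forall u,
   power_centre K e j.+1 u -> power_centre K e j [~ u, v tt])).
  move=> v; split=> -[Kv hv]; split=> //; last by move=> j u; exact: hv.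
  by move=> j u jk; exact: (hv (Ordinal jk)).
apply: dfn_and => //; apply: dfn_forall_fin => j.
apply: (@dfn_forall _ _ _ _ _ Gdef _ _ (fun u (v : unit -> G) =>
   power_centre K e j.+1 u -> power_centre K e j [~ u, v tt])).
apply: dfn_imp; first exact: (dfn_var (fun=> None) (power_centre_dfn j.+1)).
by apply: (dfn_term Gdef (power_centre_dfn j)); apply: (dterm_comm Gdef); exact: dterm_var.
Qed.

End NilpotentDefinable.

(** * Local finiteness modulo a normal subgroup *)

Section LocallyFinite.
Variable G : groupType.
Implicit Types (A B C D N S : set G) (x y z g h : G) (n : nat) (s : seq G).

Lemma group_quotients A : is_group A -> quotients A `<=` A.
Proof. by move=> [_ AM AV] _ [x Ax [y Ay <-]]; apply/AM/AV. Qed.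

Definition locally_finite_mod N A :=
  forall s, [set` s] `<=` A -> exists n, covered (generated [set` s]) N n.

Lemma covered_trans B C N n k : is_group B -> is_group C ->
  covered B C n -> covered (B `&` C) N k -> exists l, covered B N l.
Proof.
move=> gB gC /(covered_in gB)[g Bg hg] [h hh].
exists #|{: 'I_n.+1 * 'I_k.+1}|.
apply: (@covered_fin _ ('I_n.+1 * 'I_k.+1)%type (fun q => h q.2 * g q.1)) => y /hg[i [By Cy]].
have [|j Nj] := hh (y / g i); first by split=> //; exact: group_quotients Cy.
by exists (i, j); rewrite /= invgM mulgA.
Qed.

(** Schreier's lemma: with T a finite set of representatives containing 1, the
    products t x u^-1 lying in C, where x is a generator or an inverse of one and t, u are
    in T, generate a subgroup B' such that B' T is stable under the generators. Taking
    also x = 1 makes the elements of T that lie in C generators. *)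
Lemma Schreier s C n : is_group C -> covered (generated [set` s]) C n ->
  exists s', [set` s'] `<=` generated [set` s] `&` C /\
    generated [set` s] `&` C `<=` generated [set` s'].
Proof.
move=> gC cov; set B := generated _; have gB : is_group B := generated_group _.
have [g Bg hg] := covered_in gB cov; have [B1 BM BV] := gB; have [C1 CM CV] := gC.
pose T := 1 :: codom g.
pose X := 1 :: s ++ [seq x^-1 | x <- s].
pose s' := [seq z <- [seq p / u | p <- [seq t * x | t <- T, x <- X], u <- T] | `[< C z >]].
have TB t : t \in T -> B t by rewrite inE => /orP[/eqP->|/codomP[j ->]].
have XB x : x \in X -> B x.
  rewrite inE mem_cat => /or3P[/eqP->|xs|/mapP[y ys ->]] //.
    exact: sub_generated.
  by apply: (BV); exact: sub_generated.
have s'P t x u : t \in T -> x \in X -> u \in T -> C (t * x / u) -> t * x / u \in s'.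
  move=> tT xX uT Cz; rewrite mem_filter (asboolT Cz); apply/allpairsP.
  by exists (t * x, u); split=> //; apply/allpairsP; exists (t, x).
have s'BC z : z \in s' -> B z /\ C z.
  rewrite mem_filter => /andP[/asboolP Cz /allpairsP[[p u] [/allpairsP[[t x] [tT xX ->]] uT ez]]].
  split=> //; rewrite ez /=; apply: (BM); last by apply: (BV); exact: TB.
  by apply: (BM); [exact: TB|exact: XB].
exists s'; split=> [z /s'BC //|y [By Cy]].
have [B'1 B'M B'V] := generated_group [set` s'].
(* P = B' T *)
pose P := [set z | exists b t, [/\ generated [set` s'] b, t \in T & z = b * t]].
have PX z x : P z -> x \in X -> P (z * x).
  move=> [b [t [B'b tT ->]]] xX; have [j [_ Cq]] := hg (t * x) (BM _ _ (TB _ tT) (XB _ xX)).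
  have gT : g j \in T by rewrite inE codom_f orbT.
  exists (b * (t * x / g j)), (g j); split=> //; last by rewrite -!mulgA mulVg mulg1.
  by apply: B'M => //; apply: sub_generated; apply: s'P => //; exact: group_quotients Cq.
have [|z x Pz xs|b [t [B'b tT e]]] := @generated_absorb _ [set` s] P _ _ y By.
- by exists 1, 1; rewrite mulg1 inE eqxx.
- by split; apply: PX; rewrite // inE mem_cat ?map_f ?xs ?orbT.
rewrite e; apply: B'M => //; apply: sub_generated => /=.
have B'C : generated [set` s'] `<=` C.
  by apply: generated_min => // z /s'BC[].
have X1 : 1 \in X by rewrite inE eqxx.
have T1 : 1 \in T by rewrite inE eqxx.
have Ct : C t by rewrite -(mulKg b t) -e; apply: (CM) => //; apply: (CV); exact: B'C.
by have := s'P t 1 1 tT X1 T1; rewrite !divg1 mulg1; exact.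
Qed.

(** By Schreier's lemma, the part in C of a finitely generated subgroup of A is finitely
    generated. *)
Lemma locally_finite_trans A C N : is_group C ->
  locally_finite_mod C A -> locally_finite_mod N C -> locally_finite_mod N A.
Proof.
move=> gC AC CN s sA; have [n cov] := AC s sA.
have [s' [sub1 sub2]] := Schreier gC cov.
have [k [h hh]] := CN s' (fun x xs => (sub1 x xs).2).
have covN : covered (generated [set` s] `&` C) N k by exists h => y /sub2; exact: hh.
exact: covered_trans (generated_group _) gC cov covN.
Qed.

(** A subgroup generated by finitely many elements commuting modulo N and of
    exponent e modulo N; D grows by one cyclic factor at each generator. *)
Lemma commuting_covered N e s : normal_in setT N -> 0 < e ->
  (forall x, x \in s -> N (x ^+ e)) ->
  (forall x y, x \in s -> y \in s -> N [~ x, y]) ->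
  exists D n, [/\ is_group D, N `<=` D, [set` s] `<=` D, covered D N n
    & forall z, (forall x, x \in s -> N [~ z, x]) -> forall d, D d -> N [~ z, d]].
Proof.
move=> nN e0; have [gN NJ] := nN; have [N1 NM NV] := gN.
have NJV x y : N x -> N (y * x / y).
  by move=> Nx; have := NJ _ y^-1 I Nx; rewrite /conjg invgK mulgA.
have cen z : is_group [set d | N [~ z, d]].
  split=> [|x y /= Nx Ny|x /= Nx] /=; rewrite ?commg1 //.
    by rewrite commgM; apply: (NM) => //; exact: NJ.
  by rewrite commgV; apply: (NJ) => //; exact: NV.
have cenN z d : N d -> N [~ z, d].
  by move=> Nd; rewrite commgEr; apply: (NM) => //; apply: (NJ) => //; exact: NV.
elim: s => [_ _|x s IH se sc].
  exists N, 0; split=> //.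
    by exists (fun=> 1) => y Ny; exists ord0; rewrite divg1.
  by move=> z _ d; exact: cenN.
have [|y z ys zs|D [n [gD ND sD [h hD] cD]]] := IH.
- by move=> y ys; apply: se; rewrite inE ys orbT.
- by apply: sc; rewrite inE ?ys ?zs orbT.
have [D1 DM DV] := gD.
have Nxe k : N (x ^+ (k * e)).
  by rewrite mulnC expgnA; apply: group_exp => //; apply: se; rewrite inE eqxx.
pose Y := [set y | exists k, N (y / x ^+ k)].
have YE y : Y y <-> exists a k, N a /\ y = a * x ^+ k.
  split=> [[k Nk]|[a [k [Na ->]]]]; first by exists (y / x ^+ k), k; rewrite mulgVK.
  by exists k; rewrite mulgK.
have gY : is_group Y.
  split.
  - by exists 0; rewrite expg0 divg1.
  - move=> y z /YE[a [k [Na ->]]] /YE[b [l [Nb ->]]]; apply/YE.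
    exists (a * (x ^+ k * b / x ^+ k)), (k + l)%N; split; first by apply: (NM) => //; exact: NJV.
    by rewrite expgnDr !mulgA mulgVK.
  - move=> y /YE[a [k [Na ->]]]; exists (k * e.-1)%N.
    rewrite invgM -mulgA.
    have -> : x ^- k * (a^-1 / x ^+ (k * e.-1)) = x ^- k * a^-1 * x ^+ k * (x ^+ (k * e.-1) * x ^+ k)^-1.
      by rewrite invgM !mulgA mulgK.
    rewrite -expgnDr addnC -mulnS prednK //; apply: (NM); last by apply: (NV).
    by have := NJ _ (x ^+ k) I (NV _ Na); rewrite /conjg mulgA.
have covY : covered Y N e.
  rewrite -(card_ord e); apply: (@covered_fin _ 'I_e (fun k => x ^+ k)) => y /YE[a [k [Na ->]]].
  have ke : k %% e < e by rewrite ltn_mod.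
  exists (Ordinal ke) => /=; rewrite {1}(divn_eq k e) expgnDr mulgA mulgK.
  by apply: (NM).
have Yx : Y x by exists 1%N; rewrite expg1 mulgV.
have cY z : N [~ z, x] -> forall y, Y y -> N [~ z, y].
  move=> Nzx y /YE[a [k [Na ->]]]; have [_ cM _] := cen z.
  by apply: cM; [exact: cenN|exact: group_exp].
(* D' = D Y, where Y / N is the cyclic group generated by the image of x *)
pose D' := [set g | exists2 y, Y y & D (g / y)].
have D'E g : D' g <-> exists d y, [/\ D d, Y y & g = d * y].
  split=> [[y Yy Dg]|[d [y [Dd Yy ->]]]]; first by exists (g / y), y; rewrite mulgVK.
  by exists y; rewrite ?mulgK.
have DY d y : D d -> Y y -> D (y * d / y).
  move=> Dd Yy; rewrite -(mulVKg d (y * d / y)).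
  apply: (DM) => //; apply: ND.
  have -> : d^-1 * (y * d / y) = [~ d, y^-1] by rewrite /commg /conjg invgK !mulgA.
  have [_ _ cV] := cen d; apply: cV; apply: cY Yy; rewrite -invgR; apply: (NV).
  by apply: cD Dd => z zs; apply: sc; rewrite inE ?eqxx ?zs ?orbT.
have [Y1 YM YV] := gY.
exists D', #|{: 'I_e.+1 * 'I_n.+1}|; split.
- split.
  + by apply/D'E; exists 1, 1; rewrite mulg1.
  + move=> g g' /D'E[d [y [Dd Yy ->]]] /D'E[d' [y' [Dd' Yy' ->]]]; apply/D'E.
    exists (d * (y * d' / y)), (y * y'); split; [by apply: (DM) => //; exact: DY|exact: YM|].
    by rewrite !mulgA mulgVK.
  + move=> g /D'E[d [y [Dd Yy ->]]]; apply/D'E; exists (y^-1 * d^-1 / y^-1), y^-1.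
    by split; [apply: DY; [exact: DV|exact: YV]|exact: YV|rewrite mulgVK invgM].
- by move=> g Ng; apply/D'E; exists g, 1; rewrite mulg1; split=> //; exact: ND.
- move=> y; rewrite /= inE => /orP[/eqP->|ys]; apply/D'E.
    by exists 1, x; rewrite mul1g.
  by exists y, 1; rewrite mulg1; split=> //; exact: sD.
- have [q hq] := covY.
  apply: (@covered_fin _ ('I_e.+1 * 'I_n.+1)%type (fun r => h r.2 * q r.1)) => g.
  move=> /D'E[d [y [Dd Yy ->]]]; have [i Ni] := hq y Yy; have [j Nj] := hD d Dd.
  exists (i, j) => /=.
  have -> : d * y / (h j * q i) = d / h j * (h j * (y / q i) / h j) by rewrite invgM !mulgA mulgVK.
  by apply: (NM) => //; exact: NJV.
- move=> z cz g /D'E[d [y [Dd Yy ->]]]; have [_ cM _] := cen z; apply: cM.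
    by apply: cD Dd => w ws; apply: cz; rewrite inE ws orbT.
  by apply: cY Yy; apply: cz; rewrite inE eqxx.
Qed.

(** A subgroup B of A generated by finitely many elements meets their common
    centralizer modulo N in a subgroup of finite index, which is finitely generated
    and commutative modulo N, hence finite modulo N as it has finite exponent. *)
Lemma locally_finite_layer N A e : normal_in setT N -> is_group A -> 0 < e ->
  (forall x, A x -> N (x ^+ e)) ->
  (forall x, A x -> exists n, covered setT (centralizer_mod setT N x) n) ->
  locally_finite_mod N A.
Proof.
move=> nN gA e0 Ae Ac s sA; set B := generated _.
have [gN NJ] := nN; have [N1 NM NV] := gN.
pose C := [set g | forall x, x \in s -> N [~ g, x]].
have cgr x := centralizer_group x (is_groupT G) nN.
have gC : is_group C.
  have H x : is_group [set g | N [~ g, x]].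
    have [c1 cM cV] := cgr x; split=> [|g h Ng Nh|g Ng] /=.
    + by case: c1.
    + by case: (cM g h) => //; split.
    + by case: (cV g) => //; split.
  split=> [x _|g h Cg Ch x xs|g Cg x xs].
  - by have [] := H x.
  - by have [_ HM _] := H x; apply: (HM); [exact: Cg|exact: Ch].
  - by have [_ _ HV] := H x; apply: (HV); exact: Cg.
have [n cov] : exists n, covered setT C n.
  rewrite /C; elim: s sA {B C gC} => [|x s IH] sA.
    by exists 0, (fun=> 1) => y _; exists ord0.
  have [|n cs] := IH; first by move=> y ys; apply: sA; rewrite /= inE ys orbT.
  have [|k cx] := Ac x; first by apply: sA; rewrite /= inE eqxx.
  have [g hg] := covered_cap cx cs; eexists.
  apply: (covered_fin (g := g)) => y /hg[j [qx qs]]; exists j => z.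
  rewrite inE => /orP[/eqP->|zs]; first by have [] := group_quotients (cgr x) qx.
  have [g1 h1 [g2 h2 e2]] := qs.
  have [_ cM cV] := cgr z; rewrite -e2.
  have [] // := cM g1 g2^-1; first by split=> //; exact: h1.
  by apply: cV; split=> //; exact: h2.
have covB : covered B C n by have [g hg] := cov; exists g => y _; exact: hg.
have [s' [sub1 sub2]] := Schreier gC covB.
have gB : is_group B := generated_group _.
have BA : B `<=` A by exact: generated_min.
have [|x y xs ys|D [k [gD _ sD [h hD] _]]] := @commuting_covered N e s' nN e0.
- by move=> x xs; apply: Ae; apply: BA; have [] := sub1 x xs.
- have [_ Cx] := sub1 x xs; have [By _] := sub1 y ys.
  have gZ : is_group [set z | N [~ x, z]].
    have [c1 cM cV] := cgr x.
    have sw z : N [~ x, z] <-> N [~ z, x].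
      by split=> h; rewrite -invgR; exact: NV.
    split=> [|z w /sw Nz /sw Nw|z /sw Nz] /=; apply/sw; first by case: c1.
    + by case: (cM z w) => //; split.
    + by case: (cV z) => //; split.
  exact: (generated_min gZ _ By).
have covN : covered (B `&` C) N k.
  by exists h => y /sub2 By; apply: hD; exact: (generated_min gD sD).
exact: covered_trans gB gC covB covN.
Qed.

(** Climbing the FC-series: each term modulo the previous one and H has bounded
    exponent and finite conjugacy classes. *)
Lemma locally_finite_FC H K i e : normal_in setT H -> normal_in setT K -> 0 < e ->
  (forall x, K x -> H (x ^+ e)) -> H `<=` K -> K `<=` filt_union (@FC_filt G i) ->
  locally_finite_mod H K.
Proof.
move=> nH nK e0 He HK KF.
have [[H1 HM HV] HJ] := nH; have [[K1 KM KV] KJ] := nK.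
pose F j : set G := filt_union (FC_filt j).
have nF j : normal_in setT (F j) := filt_union_normal (FC_filtration G j).
(* the preimage in K of the j-th term modulo H *)
pose Q j : set G := [set x | exists f h, [/\ F j f, K f, H h & x = f * h]].
have QK j : Q j `<=` K by move=> _ [f [h [_ Kf Hh ->]]]; apply: KM => //; exact: HK.
have HQ j : H `<=` Q j.
  by move=> h Hh; exists 1, h; rewrite mul1g; split=> //; case: (nF j) => -[].
have nQ j : normal_in setT (Q j).
  have [[F1 FM FV] FJ] := nF j; split; first split.
  - exact: HQ.
  - move=> _ _ [f [h [Ff Kf Hh ->]]] [f' [h' [Ff' Kf' Hh' ->]]].
    exists (f * f'), (h ^ f' * h'); split; [exact: FM|exact: KM| |].
      by apply: HM => //; exact: HJ.
    by rewrite /conjg !mulgA mulgK.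
  - move=> _ [f [h [Ff Kf Hh ->]]]; exists f^-1, (h^-1 ^ f^-1).
    split; [exact: FV|exact: KV|by apply: HJ => //; exact: HV|].
    by rewrite /conjg invgM invgK !mulgA mulVg mul1g.
  - move=> _ g _ [f [h [Ff Kf Hh ->]]]; exists (f ^ g), (h ^ g).
    by rewrite conjMg; split; [exact: FJ|exact: KJ|exact: HJ|].
have lf j : locally_finite_mod H (Q j).
  elim: j => [|j IH].
    move=> s sQ; exists 0, (fun=> 1) => y By; exists ord0; rewrite divg1.
    apply: (generated_min _ _ By) => [|x /sQ[f [h [[_ /= ->] _ Hh ->]]]]; first by case: nH.
    by rewrite mul1g.
  have [gQ QJ] := nQ j; have [Q1 QM QV] := gQ.
  apply: locally_finite_trans gQ _ IH.
  apply: (@locally_finite_layer _ _ e) => //; first by case: (nQ j.+1).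
    by move=> x /QK/He/HQ.
  move=> _ [f [h [[N [_ cf]] Kf Hh ->]]]; exists N.
  have [n hn] := centralizer_quotients N (@is_groupT G) (FC_filtration G j).
  have [g _ hg] := covered_in (@is_groupT G) cf; exists g => y /hg[l [_ /hn[_ Fl]]].
  exists l; split=> //; rewrite commgM; apply: QM.
    by apply: HQ; rewrite commgEr; apply: HM => //; apply: HJ => //; exact: HV.
  apply: QJ => //; exists [~ y / g l, f], 1; rewrite mulg1; split=> //; first by exists n.
  by rewrite commgEr; apply: KM => //; apply: KJ => //; exact: KV.
move=> s sK; apply: (lf i) => x xs; exists x, 1; rewrite mulg1.
by split=> //; [apply: KF; exact: sK|exact: sK].
Qed.

Lemma locally_finite_index N K n : is_group K -> covered setT K n ->
  locally_finite_mod N K -> locally_finite_mod N setT.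
Proof.
move=> gK [g hg]; apply: locally_finite_trans => // s _.
by exists n, g => y _; exact: hg.
Qed.

(** The Schreier graph of the cosets of H under a closes up on r + 1 vertices: this
    is a first order condition on a, whereas finiteness modulo H of the group
    generated by a is not. *)
Definition has_transversal H d r (a : 'I_d -> G) := exists t : 'I_r.+1 -> G,
  (exists k, H (t k)) /\
  forall i j, (exists k, H (t i * a j / t k)) /\ (exists k, H (t i / a j / t k)).

Lemma has_transversalS H d r (a : 'I_d -> G) :
  has_transversal H r a -> has_transversal H r.+1 a.
Proof.
move=> [t [[k Hk] ht]]; exists (fun k => t (inord k)).
pose w (k : 'I_r.+1) : 'I_r.+2 := widen_ord (leqnSn _) k.
have wE k' : t (inord (w k')) = t k' by rewrite /= inord_val.
split; first by exists (w k); rewrite wE.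
move=> i j; have [[k1 h1] [k2 h2]] := ht (inord i) j.
by split; [exists (w k1); rewrite wE|exists (w k2); rewrite wE].
Qed.

Lemma locally_finite_transversal H d (a : 'I_d -> G) : normal_in setT H ->
  locally_finite_mod H setT -> exists r, has_transversal H r a.
Proof.
move=> nH lf; have [gH HJ] := nH; have [H1 HM HV] := gH.
have [r cov] := lf (codom a) (fun _ _ => I); exists r.
set B := generated _ in cov; have gB : is_group B := generated_group _.
have [B1 BM BV] := gB.
have [t Bt ht] := covered_in gB cov.
have Ba j : B (a j) by apply: sub_generated; rewrite /= codom_f.
have H' y : B y -> exists k, H (y / t k).
  by move=> /ht[k [_ /(group_quotients gH)]]; exists k.
exists t; split=> [|i j].
  have [k Hk] := H' 1 B1; exists k.
  by rewrite -(invgK (t k)); apply: HV; rewrite -(mul1g (t k)^-1).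
split; apply: H'; first exact: BM.
by apply: BM => //; exact: BV.
Qed.

End LocallyFinite.

Section UniformlyLocallyFinite.
Variables (L : language) (M : structure L) (G : groupType) (m : nat).
Variable c : G -> 'I_m -> M.
Hypothesis Gdef : definable_group c.
Hypothesis Msat : aleph1_saturated M.
Variable H : normal_subgroup G.
Hypothesis Hdef : dfn c set0 (fun v : unit -> G => nsub H (v tt)).

Lemma nsub_normal_in : normal_in setT (nsub H).
Proof.
by split; [exact: subgroup_is_group (nsub_closed H)|move=> x g _; exact: nsub_conj].
Qed.

Lemma has_transversal_dfn d r : dfn c set0 (fun a : 'I_d -> G => has_transversal (nsub H) r a).
Proof.
apply: (@dfn_exists_block _ _ _ _ _ Gdef _ _ _ (fun t (a : 'I_d -> G) => (exists k, nsub H (t k)) /\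
  forall i j, (exists k, nsub H (t i * a j / t k)) /\ (exists k, nsub H (t i / a j / t k)))).
apply: dfn_and.
  apply: dfn_exists_fin => k; exact: (dfn_var (fun=> inl k) Hdef).
apply: dfn_forall_fin => i; apply: dfn_forall_fin => j.
apply: dfn_and; apply: dfn_exists_fin => k; apply: (dfn_term Gdef Hdef);
  do ?[exact: dterm_var|apply: (dterm_mul Gdef)|apply: (dterm_inv Gdef)].
Qed.

Lemma quotient_map_eq x y : nsub H (x / y) -> quotient_map H x = quotient_map H y.
Proof.
move=> Hxy; apply: val_inj => /=; apply/seteqP; split=> _ [h Hh <-].
  by exists (h * (x / y)); [exact: nsubM|rewrite !mulgA mulgVK].
by exists (h * (x / y)^-1); [exact/nsubM/nsubV|rewrite invgF !mulgA mulgVK].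
Qed.

Lemma transversal_card d r (a : 'I_d -> quotient H) (b : 'I_d -> G) :
  (forall j, a j = quotient_map H (b j)) -> has_transversal (nsub H) r b ->
  (generated (range a) #<= `I_r.+1)%card.
Proof.
move=> ab [t [[k0 Hk0] ht]].
pose P : set (quotient H) := [set quotient_map H (t (inord k)) | k in `I_r.+1].
apply: card_le_trans (card_image_le (fun k => quotient_map H (t (inord k))) `I_r.+1).
apply: subset_card_le.
have PI k : P (quotient_map H (t k)) by exists k; rewrite ?inord_val //=.
apply: generated_absorb.
  have -> : 1 = quotient_map H (t k0).
    by apply: quotient_map_eq; rewrite mul1g; exact: nsubV.
  exact: PI.
move=> _ _ [k _ <-] [j _ <-]; rewrite ab.
have [[k1 h1] [k2 h2]] := ht (inord k) j.
have -> : quotient_map H (t (inord k)) * quotient_map H (b j) = quotient_map H (t k1).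
  by rewrite -(quotient_map_eq h1); exact: quotient_mapM.
have -> : quotient_map H (t (inord k)) / quotient_map H (b j) = quotient_map H (t k2).
  rewrite -(quotient_map_eq h2) -quotient_mapM -quotient_mapV.
  by [].
by split; exact: PI.
Qed.

Lemma uniformly_locally_finite_quotient :
  locally_finite_mod (nsub H) setT -> uniformly_locally_finite (quotient H).
Proof.
move=> lf d d0.
have [r hr] := saturated_uniform Gdef Msat (has_transversal_dfn d)
  (@has_transversalS _ _ d) (fun a => locally_finite_transversal a nsub_normal_in lf).
exists r.+1 => a.
have /choice[b hb] j : exists x, a j = quotient_map H x.
  by elim/quotient_ind: (a j) => x; exists x.
exact: transversal_card hb (hr b).
Qed.

End UniformlyLocallyFinite.

(** * Commuting tuples and nilpotency *)

(** Surjectivity turns invariance into equality with the image. *)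
Lemma characteristic_stable (G : groupType) (S : set G) :
  (forall f, automorphism f -> stable f S) -> characteristic S.
Proof.
move=> St f bf; have sf : stable f S by apply: St; split=> // x y; exact: gmulfM.
have [f' ff' f'f] := bf; apply/seteqP; split=> [_ [x Sx <-]|x Sx]; first exact/sf.
by exists (f' x) => //; apply/sf; rewrite f'f.
Qed.

Theorem corollary2p11
    (L : language) (M : structure L)
    (G : groupType) (m : nat) (c : G -> 'I_m -> M)
    (n : nat) (mu : forall k, set (set (k.-tuple G))) :
  countable_language L ->
  infinite_set [set: M] ->
  aleph1_saturated M ->
  definable_group c ->
  (1 <= n)%N ->
  compatible_system c n mu ->
  right_translational_S1 c (ideal_on_G (mu 1%N)) ->
  wide (mu n) [set x : n.-tuple G | left_commutator x = 1] ->
  (exists K : set G,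
     [/\ subgroup K,
         definable c set0 K,
         finite_index K [set: G]
       & FC_nilpotent K n.-1]) /\
  (exists H : normal_subgroup G,
     [/\ definable c set0 H,
         characteristic H,
         exists2 k, (k < n)%N & nilpotent_of_class H k
       & uniformly_locally_finite (quotient H)]).
Proof.
move=> _ _ Msat Gdef n0 comp S1 wn.
have id1 : ideal (coords c (k := 1)) (mu 1%N) by case: comp => idl _; apply: idl; rewrite n0.
have [N0 w1] := descent_all Gdef Msat n0 comp S1 wn.
have [k0 [n1 cov0]] := wide_FC_covered Gdef Msat id1 S1 w1.
have [k eK] := FC_union_definable cov0.
set K : set G := filt_union _ in eK.
have nK : normal_in setT K := filt_union_normal (FC_filtration G n.-1).
have gK : is_group K := nK.1.
have covK : covered setT K n1.
  by apply: covered_sub (leqnn _) cov0 => y _ g Fg; exists k0.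
have Kdfn : dfn c set0 (fun v : unit -> G => K (v tt)).
  by rewrite eK; exact: FC_filt_dfn.
have Kst f : automorphism f -> stable f K.
  by move=> af; rewrite eK; exact: FC_filt_stable.
split.
  exists K; split.
  - exact: is_group_subgroup.
  - exact: definable_of_dfn1.
  - by apply/(finite_indexP (is_groupT G) gK) => //; exists n1.
  apply/seteqP; split=> [x Kx|x]; first by apply: FC_filt_series.
  by case: (n.-1) => [/= ->|i []//]; case: gK.
have [e e0 he] := FC_filt_power gK n.-1 k.
have nH := nil_part_normal n.-1 e gK nK.
pose H := NormalSubgroup (is_group_subgroup nH.1) (fun x g => nH.2 x g I).
have Hdfn : dfn c set0 (fun v : unit -> G => nsub H (v tt)) by exact: nil_part_dfn.
exists H; split.
- exact: definable_of_dfn1.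
- by apply: characteristic_stable => f af; apply: nil_part_stable => //; exact: Kst.
- have [|j jn Hj] := @nil_part_nilpotent G K n.-1 e gK nK.
    by move=> x Kx; apply: he; split=> //; rewrite -eK.
  by exists j => //; rewrite -(prednK n0) ltnS.
apply: (uniformly_locally_finite_quotient Gdef Msat Hdfn).
apply: locally_finite_index gK covK _.
apply: (locally_finite_FC (e := e) (i := n.-1)) => //.
- by move=> x Kx; exact: (nil_part_power n.-1 e nK.1 Kx).
- by move=> x [].
Qed.
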